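(* Let $G$ be an amenable countable infinite residually finite (discrete) group and let $\overleftarrow{G}$ be a totally disconnected metric compactification of $G$. Then there exists an irregular mean-equicontinuous Toeplitz subshift (over $G$) whose maximal equicontinuous factor is $\overleftarrow{G}$.
   Context: A totally disconnected metric compactification of $G$ is a totally disconnected compact metrizable group $\overleftarrow{G}$ for which there is an injective homomorphism $\iota:G\to\overleftarrow{G}$ with dense image; $G$ acts on $\overleftarrow{G}$ by $\phi^g(y)=\iota(g)y$. This system is minimal, equicontinuous and uniquely ergodic, its unique invariant probability measure being the Haar measure $\nu$. A dynamical system $(X,\sigma,G)$ is a continuous left action of $G$ on a compact metric space $X$. For a finite set $\Sigma$ with $|\Sigma|\ge2$, $G$ acts on $\Sigma^G$ (product topology) by the shift $\sigma^g x(h)=x(g^{-1}h)$; $O_\sigma(x)=\{\sigma^g x:g\in G\}$. For $x\in\Sigma^G$ and a finite index subgroup $\Gamma\le G$, $\mathrm{Per}(x,\Gamma)=\{g\in G: x(\gamma g)=x(g)\ \forall\gamma\in\Gamma\}$. An element $\eta\in\Sigma^G$ is a Toeplitz array if for each $g\in G$ there is a finite index subgroup $\Gamma$ with $g\in\mathrm{Per}(\eta,\Gamma)$. A Toeplitz subshift is a set $\overline{O_\sigma(\eta)}$ with $\eta$ a Toeplitz array, with the shift action. A factor map $\pi:X\to Y$ is a continuous surjective $G$-equivariant map. The maximal equicontinuous factor of $X$ is an equicontinuous system $Y$ with a factor map $\pi:X\to Y$ through which every factor map from $X$ to an equicontinuous system factors. If the maximal equicontinuous factor of $\overline{O_\sigma(\eta)}$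 is $\overleftarrow{G}$ with factor map $\pi$, and $\mathcal{T}$ is the set of Toeplitz arrays in $\overline{O_\sigma(\eta)}$, then $\eta$ (and the subshift it generates) is regular if $\nu(\pi(\mathcal{T}))=1$, and irregular otherwise. A (left) Følner sequence is a sequence $(F_n)$ of nonempty finite subsets of $G$ with $|gF_n\triangle F_n|/|F_n|\to0$ for all $g\in G$; $G$ is amenable if one exists. For amenable $G$, a system $(X,\sigma,G)$ with metric $d$ on $X$ is mean-equicontinuous if for all $\varepsilon>0$ there is $\delta>0$ such that $d(x,z)<\delta$ implies $\sup_{(F_n)}\limsup_{n\to\infty}\frac1{|F_n|}\sum_{g\in F_n}d(\sigma^gx,\sigma^gz)<\varepsilon$, the supremum being over all Følner sequences. *)

(* Defs.v *)
From HB Require Import structures.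
From mathcomp Require Import all_boot all_order all_algebra.
From mathcomp Require Import finmap.
From mathcomp Require Import all_classical all_reals all_analysis.

Set Implicit Arguments.
Unset Strict Implicit.
Unset Printing Implicit Defensive.

Import Order.TTheory GRing.Theory Num.Theory.
Import numFieldTopology.Exports.

Local Open Scope classical_set_scope.
Local Open Scope ring_scope.

(* Groups are MathComp's possibly infinite [groupType]s, always regarded as
   discrete; topological groups are the [topGroupType]s below. *)

Section Groups.
Variable G : groupType.

Definition subgroup (H : set G) : Prop :=
  [/\ H 1%g, (forall x y, H x -> H y -> H (x * y)%g)
    & (forall x, H x -> H x^-1%g)].

Definition left_cosets (H : set G) : set (set G) :=
  [set [set (g * h)%g | h in H] | g in [set: G]].

Definition finite_index_subgroup (H : set G) : Prop :=
  subgroup H /\ finite_set (left_cosets H).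

Definition normal_subset (H : set G) : Prop :=
  forall g h, H h -> H (g * h * g^-1)%g.

Definition residually_finite : Prop :=
  forall g : G, g != 1%g ->
    exists H : set G, [/\ finite_index_subgroup H, normal_subset H & ~ H g].

Definition symdiff (A B : {fset G}) : {fset G} :=
  ((A `\` B) `|` (B `\` A))%fset.

Definition ltranslate (g : G) (F : {fset G}) : {fset G} :=
  [fset (g * h)%g | h in F]%fset.

Definition folner (R : realType) (F : nat -> {fset G}) : Prop :=
  (forall n, F n != fset0) /\
  (forall g : G,
    (#|` symdiff (ltranslate g (F n)) (F n)|%:R / #|` F n|%:R : R)
      @[n --> \oo] --> (0 : R)).

Definition amenable (R : realType) : Prop :=
  exists F : nat -> {fset G}, folner R F.

End Groups.

Section Metrics.
Variables (R : realType) (X : topologicalType).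

(* [d] is a metric inducing the given topology of [X]. *)
Definition compatible_metric (d : X -> X -> R) : Prop :=
  [/\ (forall x y, d x y = 0 <-> x = y),
      (forall x y, d x y = d y x),
      (forall x y z, d x z <= d x y + d y z)
    & (forall x (A : set X),
        nbhs x A <-> exists2 e, 0 < e & [set y | d x y < e] `<=` A)].

Definition metrizable : Prop := exists d, compatible_metric d.

End Metrics.

Section Systems.
Variables (R : realType) (G : groupType).

(* As [G] is discrete, the action is continuous when each [act g] is. *)
Definition dynamical_system (X : topologicalType) (act : G -> X -> X) : Prop :=
  [/\ compact [set: X], metrizable R X,
      (forall x, act 1%g x = x),
      (forall g h x, act (g * h)%g x = act g (act h x))
    & (forall g, continuous (act g))].

(* A metrizable space carries no preferred metric here. On a compact space
   neither this notion nor [mean_equicontinuous] depends on which compatible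
   metric is used, so both are required of all of them. *)
Definition equicontinuous_system (X : topologicalType) (act : G -> X -> X) :
    Prop :=
  dynamical_system act /\
  forall d : X -> X -> R, compatible_metric d ->
    forall eps, 0 < eps -> exists2 delta, 0 < delta &
      forall x y, d x y < delta -> forall g, d (act g x) (act g y) < eps.

Definition mean_distance (X : topologicalType) (act : G -> X -> X)
    (d : X -> X -> R) (x z : X) (F : {fset G}) : R :=
  (#|` F|%:R)^-1 * \sum_(g <- F) d (act g x) (act g z).

Definition mean_equicontinuous (X : topologicalType) (act : G -> X -> X) :
    Prop :=
  dynamical_system act /\
  forall d : X -> X -> R, compatible_metric d ->
    forall eps, 0 < eps -> exists2 delta, 0 < delta &
      forall x z, d x z < delta ->
        (ereal_sup
          [set limn_esup (fun n => (mean_distance act d x z (F n))%:E)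
             | F in [set F | folner R F]] < eps%:E)%E.

Definition factor_map (X Y : topologicalType) (actX : G -> X -> X)
    (actY : G -> Y -> Y) (f : X -> Y) : Prop :=
  [/\ continuous f, range f = [set: Y]
    & (forall g x, f (actX g x) = actY g (f x))].

Definition maximal_equicontinuous_factor (X Y : topologicalType)
    (actX : G -> X -> X) (actY : G -> Y -> Y) (pi : X -> Y) : Prop :=
  [/\ equicontinuous_system actY, factor_map actX actY pi
    & (forall (Z : topologicalType) (actZ : G -> Z -> Z) (psi : X -> Z),
        equicontinuous_system actZ -> factor_map actX actZ psi ->
        exists2 chi : Y -> Z, factor_map actY actZ chi & psi = chi \o pi)].

End Systems.

Lemma ptws_precomp_continuous (I : eqType) (T : topologicalType) (f : I -> I) :
  continuous ((fun x i => x (f i)) : {ptws I -> T} -> {ptws I -> T}).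
Proof.
move=> x; apply/cvg_sup => [|i].
  exact/fmap_filter/(nbhs_filter (x : {ptws I -> T})).
move=> A [B [[U oU <-] /= Ux UA]].
have /(_ x) h : continuous (fun z : {ptws I -> T} => z (f i)).
  exact: (@proj_continuous I (fun _ => T) (f i)).
have /h nU : nbhs (x (f i)) U by exact: open_nbhs_nbhs.
rewrite /= nbhs_simpl /=.
have FF := nbhs_filter (x : {ptws I -> T}).
by apply: (@filterS _ _ FF _ _ _ nU) => z Uz; exact: UA.
Qed.

Section Shift.
Variables (G : groupType) (S : finType).

Definition config : Type := {ptws G -> discrete_topology S}.
HB.instance Definition _ := Topological.on config.

Definition gshift (g : G) (x : config) : config := fun h => x (g^-1 * h)%g.

Definition gorbit (x : config) : set config := [set gshift g x | g in [set: G]].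

Definition Per (x : config) (H : set G) : set G :=
  [set g | forall c, H c -> x (c * g)%g = x g].

Definition toeplitz (x : config) : Prop :=
  forall g, exists2 H, finite_index_subgroup H & Per x H g.

Lemma gshift_continuous g : continuous (gshift g).
Proof.
exact: (@ptws_precomp_continuous G (discrete_topology S)
  (fun h => g^-1 * h)%g).
Qed.

Lemma gshift_orbit g eta x : gorbit eta x -> gorbit eta (gshift g x).
Proof.
move=> [h _ <-]; exists (g * h)%g => //.
by apply/funext => k; rewrite /gshift invgM mulgA.
Qed.

Lemma orbit_closure_gshift (eta : config) g x :
  closure (gorbit eta) x -> closure (gorbit eta) (gshift g x).
Proof.
move=> clx B /gshift_continuous /clx[y [oy By]].
by exists (gshift g y); split => //; exact: gshift_orbit.
Qed.

Definition subshift (eta : config) : Type := set_type (closure (gorbit eta)).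
HB.instance Definition _ eta := Topological.on (subshift eta).

Definition subshift_act (eta : config) (g : G) (x : subshift eta) :
    subshift eta :=
  SigSub (mem_set (@orbit_closure_gshift eta g (set_val x) (set_valP x))).

Definition toeplitz_points (eta : config) : set (subshift eta) :=
  [set x | toeplitz (set_val x)].

End Shift.

Arguments subshift_act {G S} eta g x.
Arguments toeplitz_points {G S} eta _.

HB.mixin Record isTopGroup K & PointedTopological K & Group K := {
  mulg_continuous : continuous (fun p : K * K => (p.1 * p.2)%g);
  invg_continuous : continuous (fun x : K => x^-1%g)
}.

#[short(type="topGroupType")]
HB.structure Definition TopGroup :=
  { K of isTopGroup K & PointedTopological K & Group K }.

Section Compactification.
Variables (R : realType) (G : groupType) (K : topGroupType).

Definition totally_disconnected_metric_compactification (iota : G -> K) :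
    Prop :=
  [/\ compact [set: K], metrizable R K & totally_disconnected [set: K]] /\
  [/\ injective iota, {morph iota : x y / (x * y)%g} & dense (range iota)].

Definition translation (iota : G -> K) (g : G) (y : K) : K := (iota g * y)%g.

Definition borel_type := g_sigma_algebraType (@open K).
HB.instance Definition _ := Measurable.on borel_type.

Definition haar_probability (nu : probability borel_type R) : Prop :=
  forall (k : K) (A : set borel_type), measurable A ->
    nu [set (k * y)%g | y in (A : set K)] = nu A.

End Compactification.

Section Regularity.
Variables (R : realType) (G : groupType) (K : topGroupType) (S : finType).
Variables (eta : config G S) (nu : probability (borel_type K) R).

(* Here [pi] is the factor map onto the maximal equicontinuous factor and [nu]
   its Haar measure. *)
Definition regular (pi : subshift eta -> K) : Prop :=
  nu (pi @` toeplitz_points eta) = 1%E.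

(* A library measure takes unspecified values off the sigma-algebra, so the
   negation of [regular] alone would carry no information for a non-measurable
   image. *)
Definition irregular (pi : subshift eta -> K) : Prop :=
  measurable (pi @` toeplitz_points eta : set (borel_type K)) /\ ~ regular pi.

End Regularity.

(* Main.v *)
(* Color the compactification [K] by a function that is locally constant on a
   dense open set [C] containing the image of [G], and read it along [iota] to
   get the Toeplitz array [eta].  The set [C] is exhausted by clopen sets [W n]
   together with clopen marks [M n] in [W n.+1] minus [W n], and a point is
   colored by the parity of the mark containing it.  The steps are arranged so
   that
   - the complement of [C] has positive Haar measure and each of its points is a
     limit of marks and of unmarked open sets, which makes [eta] irregular;
   - the marks of odd index accumulate at a single point [p] outside [C], so the
     coloring has no translation symmetry and the points of the subshift
     determine points of [K];
   - late marks are never translates of each other by one of the first elements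
     of [G].  Hence a point of the subshift carries at most one mark in its
     holes: fibers are proximal, so that [K] is the maximal equicontinuous
     factor, and two points over nearby points of [K] differ on a set with many
     disjoint translates, thus of small density for every Folner sequence. *)

Require Import Defs.
From mathcomp Require Import all_boot all_order all_algebra.
From mathcomp Require Import finmap.
From mathcomp Require Import all_classical all_reals all_analysis.
From mathcomp Require Import lra.

Set Implicit Arguments.
Unset Strict Implicit.
Unset Printing Implicit Defensive.

Import Order.TTheory GRing.Theory Num.Theory.
Import numFieldTopology.Exports.

Local Open Scope classical_set_scope.
Local Open Scope ring_scope.

(** * Topological preliminaries *)

(** In a compact Hausdorff space the quasi-component [Q] of a point, the intersection of its clopen
    neighborhoods, is connected. If no clopen set separated [x] from [y], both would thus lie in one
    connected component. *)
Lemma totally_disconnected_zero_dimensional (R : realType) (T : topologicalType) :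
  hausdorff_space T -> compact [set: T] -> totally_disconnected [set: T] ->
  zero_dimensional T.
Proof.
move=> hT cT tdT x y xy.
apply: contrapT => noU.
pose Q := [set z | forall C : set T, clopen C -> C x -> C z].
have Qx : Q x by [].
have Qy : Q y.
  by move=> C clC Cx; apply: contrapT => nCy; apply: noU; exists C.
suff cQ : connected Q.
  have : connected_component [set: T] x y by exists Q.
  by rewrite tdT// => /esym/eqP; exact/negP.
have clQ : closed Q.
  have -> : Q = \bigcap_(C in [set C : set T | clopen C /\ C x]) C.
    apply/seteqP; split => [z Qz C [clC Cx]|z Qz C clC Cx]; first exact: Qz.
    by apply: Qz; split.
  by apply: closed_bigI => C [[_ clC] _].
move=> B [b Bb] [C oC BC] [D cD BD].
have clB : closed B by rewrite BD; exact: closedI.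
have clA : closed (Q `&` ~` C) by apply: closedI => //; exact: open_closedC.
have AB : B `&` (Q `&` ~` C) = set0.
  by apply/seteqP; split=> // z; rewrite BC => -[[_ Cz] [_ /(_ Cz)]].
(* [B] and its complement in [Q] are closed and disjoint, so normality thickens them to [U] and [V].
   A clopen [E] around [x] inside their union is then cut by [U] into two clopen pieces, and the
   piece containing [x] contains all of [Q]. *)
have [U [V [oU oV BU AV UV]]] :=
  (@normal_openP R T).1 (compact_normal hT cT) _ _ clB clA AB.
have QUV : Q `<=` U `|` V.
  move=> z Qz; have [Cz|nCz] := pselect (C z); last by right; apply: AV.
  by left; apply: BU; rewrite BC.
have [E [[oE cE] Ex EUV]] : exists E : set T, [/\ clopen E, E x & E `<=` U `|` V].
  pose F := filter_from [set D : set T | D x /\ clopen D] id.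
  have FF : Filter F.
    apply: filter_from_filter; first by exists setT; split => //; exact: clopenT.
    move=> S S' [? ?] [? ?]; exists (S `&` S') => //; split=> //.
    exact: clopenI.
  have PF : ProperFilter F by apply: filter_from_proper => // S [Sx _]; exists x.
  (* The clopen neighborhoods of [x] are stable under intersection and jointly miss this compact
     set, so a single one of them misses it. *)
  have /compact_near_coveringP : compact (~` (U `|` V)).
    apply: (subclosed_compact _ cT) => //.
    exact/open_closedC/openU.
  move=> /(_ _ _ setC (powerset_filter_from_filter PF))[].
    move=> z nUVz; have [S [clS Sx nSz]] : exists S, [/\ clopen S, S x & ~ S z].
      apply: contrapT => noS; apply/nUVz/QUV => S clS Sx.
      by apply: contrapT => nSz; apply: noS; exists S.
    exists (~` S, [set S' | S' `<=` S]); first split.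
    - by case: clS => oS cS; apply: open_nbhs_nbhs; split => //; exact: closed_openC.
    - apply/near_powerset_filter_fromP; first by move=> ? ?; exact: subset_trans.
      by exists S => //; exists S.
    - by case=> i j [? /subsetC]; apply.
  move=> S [SF _ [S' SS']] /(_ _ SS') sub.
  have [E [Ex clE] ES'] := SF _ SS'; exists E; split=> // z Ez.
  by apply: contrapT => /sub; apply; exact: ES'.
have clEU : clopen (E `&` U).
  split; first exact: openI.
  have -> : E `&` U = E `&` ~` V.
    apply/seteqP; split => z [Ez].
      by move=> Uz; split=> // Vz; have : (U `&` V) z by []; rewrite UV.
    by move=> nVz; split=> //; case: (EUV _ Ez).
  by apply: closedI => //; exact: open_closedC.
have [Ux|Vx] := QUV _ Qx.
  apply/seteqP; split=> [z|z Qz]; first by rewrite BC => -[].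
  have [_ Uz] := Qz _ clEU (conj Ex Ux).
  rewrite BC; split=> //; apply: contrapT => nCz.
  have : (U `&` V) z by split=> //; apply: AV.
  by rewrite UV.
have nUx : ~ U x by move=> Ux; have : (U `&` V) x by []; rewrite UV.
have Qb : Q b by move: Bb; rewrite BC => -[].
have clEV : clopen (E `&` ~` U).
  split; last by apply: closedI => //; exact: open_closedC.
  have -> : E `&` ~` U = E `&` V.
    apply/seteqP; split => z [Ez].
      by move=> nUz; split=> //; case: (EUV _ Ez).
    by move=> Vz; split=> // Uz; have : (U `&` V) z by []; rewrite UV.
  exact: openI.
by have [_ /(_ (BU _ Bb))] := Qb _ clEV (conj Ex nUx).
Qed.

Section CompatibleMetric.
Variables (R : realType) (X : topologicalType) (d : X -> X -> R).
Hypothesis dP : compatible_metric d.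

Lemma compatible_metric_refl x : d x x = 0.
Proof. by case: dP => d0 _ _ _; apply/d0. Qed.

Lemma compatible_metric_ge0 x y : 0 <= d x y.
Proof.
case: dP => d0 dC dT _; have := dT x y x.
by rewrite (dC y x) compatible_metric_refl -mulr2n pmulrn_lge0.
Qed.

Lemma compatible_metric_ball x e : 0 < e -> nbhs x [set y | d x y < e].
Proof. by case: dP => _ _ _ dN e0; apply/dN; exists e. Qed.

Lemma compatible_metric_hausdorff : hausdorff_space X.
Proof.
case: (dP) => d0 dC dT _ x y /= xy; apply/d0/eqP; apply: contraT => dxy.
have xy0 : 0 < d x y / 2 by rewrite divr_gt0// lt_neqAle eq_sym dxy compatible_metric_ge0.
have [z [/= xz yz]] := xy _ _ (compatible_metric_ball x xy0) (compatible_metric_ball y xy0).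
have : d x y < d x y / 2 + d x y / 2.
  by apply: le_lt_trans (dT x z y) _; rewrite ltrD// dC.
by rewrite -splitr ltxx.
Qed.

Hypothesis cX : compact [set: X].

(** A Lebesgue number for the cover by the sets [N], phrased for a relation so that local statements
    about pairs become uniform ones. *)
Lemma lebesgue_number (A : X -> X -> Prop) :
  (forall x : X, exists2 N : set X, nbhs x N & forall y z, N y -> N z -> A y z) ->
  exists2 e, 0 < e & forall y z, d y z < e -> A y z.
Proof.
case: (dP) => d0 dC dT dN hA.
have /compact_near_coveringP cov := cX.
have := cov _ (0^'+ : set_system R) (fun e y => forall z, d y z < e -> A y z) _ _.
case=> [x _|].
  have [N /dN[r r0 rN] NA] := hA x.
  have r20 : 0 < r / 2 by rewrite divr_gt0.
  exists ([set y | d x y < r / 2], [set e | e < r / 2]).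
    by split; [exact: compatible_metric_ball | exact: nbhs_right_lt].
  move=> [y e] /= [xy er] z yz; apply: NA; apply: rN => /=.
    by rewrite (lt_trans xy)// ltr_pdivrMr// mulr_natr mulr2n ltrDl.
  by rewrite (le_lt_trans (dT x y z))// (splitr r) ltrD// (lt_trans yz).
move=> r /= r0 rA; exists (r / 2); first by rewrite divr_gt0.
move=> y z; apply: rA => //=; last by rewrite divr_gt0.
by rewrite sub0r normrN gtr0_norm ?divr_gt0// ltr_pdivrMr// mulr_natr mulr2n ltrDl.
Qed.

Lemma compatible_metric_bounded : exists M, forall x y, d x y <= M.
Proof.
case: (dP) => d0 dC dT dN.
have [[x0 _]|X0] := pselect (exists x : X, True); last first.
  by exists 0 => x; case: X0; exists x.
have /compact_near_coveringP cov := cX.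
have := cov _ (pinfty_nbhs R) (fun M y => d x0 y <= M) _ _.
case=> [x _|].
  exists ([set y | d x y < 1], [set e | d x0 x + 1 < e]).
    by split; [exact: compatible_metric_ball | apply: nbhs_pinfty_gt; exact: num_real].
  by move=> [y e] /= [xy /ltW]; apply: le_trans; rewrite (le_trans (dT _ x _))// lerD2l ltW.
move=> M [_ MA]; exists ((M + 1) + (M + 1)) => x y.
have h z : d x0 z <= M + 1 by apply: MA => //; rewrite ltrDl.
by rewrite (le_trans (dT _ x0 _))// lerD// dC.
Qed.

End CompatibleMetric.

Section TopGroups.
Variable K : topGroupType.
Implicit Types (H : set K) (a b x y w : K).

Lemma cvg_mulg (T : Type) (F : set_system T) (f g : T -> K) a b :
  Filter F -> f @ F --> a -> g @ F --> b -> (fun t => (f t * g t)%g) @ F --> (a * b)%g.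
Proof.
move=> FF fa gb.
exact: (@continuous2_cvg T K K K F FF f g (fun x y : K => (x * y)%g) a b
  (@mulg_continuous K (a, b)) fa gb).
Qed.

Lemma mulgl_continuous a : continuous (fun x => (a * x)%g).
Proof. by move=> x; apply: cvg_mulg; [exact: cvg_cst | exact: cvg_id]. Qed.

Lemma near_mulgl a x (P : set K) :
  nbhs (a * x)%g P -> nbhs x [set y | P (a * y)%g].
Proof. exact: (@mulgl_continuous a x). Qed.

Lemma open_mulgl a (U : set K) : open U -> open [set y | U (a * y)%g].
Proof. by move=> oU; apply: (open_comp (f := fun x => (a * x)%g)) => // x _; exact: mulgl_continuous. Qed.

Definition locally_constant (X : topologicalType) (T : Type) (phi : X -> T) :=
  forall x : X, \forall y \near x, phi y = phi x.

Hypothesis cK : compact [set: K].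

(** Near [x = 1] both sides are locally constant in all variables; compactness of [K * K] makes the
    neighborhood of the identity independent of [a] and [b]. *)
Lemma locally_constant_uniform (T : Type) (phi : K -> T) :
  locally_constant phi ->
  \forall x \near (1%g : K), forall a b, phi (a * x * b)%g = phi (a * b)%g.
Proof.
move=> lc.
have /compact_near_coveringP cov : compact [set: K * K].
  by rewrite -setXTT; exact: compact_setX.
have {}cov := cov _ (nbhs (1%g : K))
  (fun x (ab : K * K) => phi (ab.1 * x * ab.2)%g = phi (ab.1 * ab.2)%g)
  (nbhs_filter _).
apply: filterS (cov _) => [x xN a b|[a b] _ /=]; first exact: (xN (a, b) I).
  have n1 : \forall q \near ((a, b), 1%g : K), phi (q.1.1 * q.2 * q.1.2)%g = phi (a * b)%g.
    have : (fun q : (K * K) * K => (q.1.1 * q.2 * q.1.2)%g) @ ((a, b), 1%g : K)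
        --> (a * 1 * b)%g.
      apply: cvg_mulg; first apply: cvg_mulg.
      - by apply: (cvg_comp fst fst (G := nbhs (a, b))); exact: cvg_fst.
      - exact: cvg_snd.
      - by apply: (cvg_comp fst snd (G := nbhs (a, b))); [exact: cvg_fst | exact: cvg_snd].
    by move/(_ [set w | phi w = phi (a * b)%g]); apply; rewrite mulg1; exact: lc.
  have n2 : \forall q \near ((a, b), 1%g : K), phi (q.1.1 * q.1.2)%g = phi (a * b)%g.
    have : (fun q : (K * K) * K => (q.1.1 * q.1.2)%g) @ ((a, b), 1%g : K)
        --> (a * b)%g.
      apply: cvg_mulg.
      - by apply: (cvg_comp fst fst (G := nbhs (a, b))); exact: cvg_fst.
      - by apply: (cvg_comp fst snd (G := nbhs (a, b))); [exact: cvg_fst | exact: cvg_snd].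
    by move/(_ [set w | phi w = phi (a * b)%g]); apply; exact: lc.
  by apply: filterS2 n1 n2 => q -> ->.
Qed.

End TopGroups.

(** * Open normal subgroups and Haar measure *)

Section OpenNormal.
Variable K : topGroupType.
Implicit Types (H : set K) (a b x y w : K).

Definition open_normal H := [/\ open H, subgroup H & normal_subset H].

Definition lcoset a H : set K := [set w | H (a^-1 * w)%g].

Lemma subgroup_open H : subgroup H -> nbhs (1%g : K) H -> open H.
Proof.
move=> [H1 HM HV] nH; rewrite openE => h Hh.
have : nbhs h [set y | H (h^-1 * y)%g] by apply: near_mulgl; rewrite mulVg.
by apply: filterS => y /(HM _ _ Hh); rewrite mulVKg.
Qed.

Lemma lcoset_open a H : open H -> open (lcoset a H).
Proof. exact: open_mulgl. Qed.

Lemma lcoset_clopen a H : open H -> subgroup H -> clopen (lcoset a H).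
Proof.
move=> oH [H1 HM HV]; split; first exact: lcoset_open.
rewrite -[lcoset a H]setCK; apply: open_closedC; rewrite openE => w nHw.
have : nbhs w (lcoset w H).
  by apply: open_nbhs_nbhs; split; [exact: lcoset_open | rewrite /lcoset/= mulVg].
apply: filterS => y wy ay; apply: nHw.
rewrite /lcoset/= -[w](mulVKg y) mulgA; apply: (HM) => //.
by rewrite -[X in H X]invgK invgM invgK; exact: HV.
Qed.

Lemma lcoset_refl a H : subgroup H -> lcoset a H a.
Proof. by case=> H1 _ _; rewrite /lcoset/= mulVg. Qed.

Lemma clopen_locally_constant (X : topologicalType) (U : set X) :
  clopen U -> locally_constant U.
Proof.
move=> [oU cU] x; have [Ux|nUx] := pselect (U x).
  have : nbhs x U by exact: open_nbhs_nbhs.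
  by apply: filterS => y Uy; apply/propext.
have : nbhs x (~` U) by apply: open_nbhs_nbhs; split=> //; exact: closed_openC.
by apply: filterS => y nUy; apply/propext.
Qed.

Hypothesis cK : compact [set: K].

(** The two-sided periods of [phi] always form a normal subgroup, and uniformity makes it open. In
    effect [phi] factors through a finite quotient of [K]. *)
Lemma locally_constant_period (T : Type) (phi : K -> T) :
  locally_constant phi ->
  exists2 H, open_normal H &
    forall x, H x -> forall a b, phi (a * x * b)%g = phi (a * b)%g.
Proof.
move=> lc; exists [set x | forall a b, phi (a * x * b)%g = phi (a * b)%g] => //.
have sH : subgroup [set x | forall a b, phi (a * x * b)%g = phi (a * b)%g].
  split=> [a b|x y hx hy a b|x hx a b].
  - by rewrite mulg1.
  - by rewrite mulgA hy hx.
  - by rewrite -[in LHS](hx (a * x^-1)%g b) mulgVK.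
split=> //; first by apply: subgroup_open => //; exact: locally_constant_uniform.
move=> g h hh a b /=.
by rewrite !mulgA -(mulgA _ g^-1%g b) hh !mulgA mulgK.
Qed.

Hypothesis hK : hausdorff_space K.
Hypothesis zK : zero_dimensional K.

(** Every period of the indicator of a clopen neighborhood [V] of [1] lies in [V]. *)
Lemma open_normal_nbhs (O : set K) :
  nbhs (1%g : K) O -> exists2 H, open_normal H & H `<=` O.
Proof.
move=> nO; have [V [V1 clV] VO] := zero_dimensional_cvg hK zK cK nO.
have [H onH HV] := locally_constant_period (clopen_locally_constant clV).
exists H => // x /HV /(_ 1%g 1%g); rewrite !mul1g !mulg1 => e.
by apply: VO; rewrite /id e.
Qed.

Lemma closed_point x : closed [set x].
Proof. exact: (accessible_closed_set1 (hausdorff_accessible hK)). Qed.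

Lemma near_neq x y : x <> y -> \forall z \near x, z <> y.
Proof.
move=> xy; apply: open_nbhs_nbhs; split=> //.
by exact/closed_openC/closed_point.
Qed.

Lemma near_all_seq (I : eqType) (s : seq I) (T : Type) (F : set_system T)
    (FF : Filter F) (P : I -> T -> Prop) :
  (forall i, i \in s -> \forall x \near F, P i x) ->
  \forall x \near F, forall i, i \in s -> P i x.
Proof.
elim: s => [_|i s ih h]; first exact: filterE.
have := ih (fun j js => h j (mem_behead (s := i :: s) js)).
apply: filterS2 (h i (mem_head _ _)) => x Pi Ps j.
by rewrite inE => /predU1P[->|/Ps].
Qed.

End OpenNormal.

Section Haar.
Variables (R : realType) (K : topGroupType) (nu : probability (borel_type K) R).
Hypothesis nu_haar : haar_probability nu.
Implicit Types (H : set K).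

Lemma borel_open (U : set K) : open U -> measurable (U : set (borel_type K)).
Proof. exact: sub_sigma_algebra. Qed.

Lemma borel_closed (C : set K) : closed C -> measurable (C : set (borel_type K)).
Proof.
move=> cC; have := measurableC (borel_open (closed_openC cC)).
by rewrite setCK.
Qed.

Lemma borel_openU (U V : set K) : open U -> open V -> U `&` V = set0 ->
  (nu (U `|` V) = nu U + nu V)%E.
Proof.
move=> oU oV UV.
exact: (measureU nu (borel_open oU) (borel_open oV) UV).
Qed.

Lemma borel_openU2 (U V : set K) : open U -> open V ->
  (nu (U `|` V) <= nu U + nu V)%E.
Proof. by move=> oU oV; exact: (measureU2 nu (borel_open oU) (borel_open oV)). Qed.

Lemma borel_open_fin_num (U : set K) : open U -> nu U \is a fin_num.
Proof. by move=> oU; exact: (fin_num_measure nu _ (borel_open oU)). Qed.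

Lemma haar_lcoset a H : open H -> nu (lcoset a H) = nu H.
Proof.
move=> oH; rewrite -(nu_haar a (borel_open oH)); congr (nu _).
apply/seteqP; split=> [w Hw|_ [y Hy <-]] /=; last by rewrite /lcoset/= mulKg.
by exists (a^-1 * w)%g => //; rewrite mulVKg.
Qed.

(** The cosets of [H] at the elements of [s] are pairwise disjoint and of equal measure, so their
    total is bounded by the mass of [K]. *)
Lemma haar_disjoint_lcosets H (s : seq K) : open H -> subgroup H ->
  (forall x y, x \in s -> y \in s -> H (x^-1 * y)%g -> x = y) -> uniq s ->
  ((size s)%:R%:E * nu H <= 1)%E.
Proof.
move=> oH [H1 HM HV] sep us.
pose U (t : seq K) := [set w | exists2 x, x \in t & lcoset x H w].
have oU t : open (U t).
  rewrite openE => w [x xt xw].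
  have : nbhs w (lcoset x H) by apply: open_nbhs_nbhs; split => //; exact: lcoset_open.
  by apply: filterS => z xz; exists x.
suff h t : uniq t -> {subset t <= s} -> nu (U t) = ((size t)%:R%:E * nu H)%E.
  by rewrite -h//; apply: probability_le1; exact: borel_open.
elim: t => [_ _|x t ih /= /andP[xt ut] ts].
  rewrite (_ : U [::] = set0) ?measure0 ?mul0e//.
  by apply/seteqP; split=> // w [].
have -> : U (x :: t) = lcoset x H `|` U t.
  apply/seteqP; split=> w.
    by move=> [y]; rewrite inE => /predU1P[->|yt] yw; [left | right; exists y].
  move=> [xw|[y yt yw]]; first by exists x => //; rewrite mem_head.
  by exists y => //; rewrite inE yt orbT.
have dis : lcoset x H `&` U t = set0.
  apply/seteqP; split=> // w [xw [y yt yw]].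
  have e : x = y.
    apply: sep; [by apply: ts; rewrite mem_head | by apply: ts; rewrite inE yt orbT|].
    have -> : (x^-1 * y = (x^-1 * w) * (y^-1 * w)^-1)%g.
      by rewrite invgM invgK mulgA mulgK.
    by apply: HM => //; exact: HV.
  by move: xt; rewrite e yt.
rewrite (borel_openU (lcoset_open x oH) (oU t) dis).
have {}ih := ih ut (fun y yt => ts y (mem_behead (s := x :: t) yt)).
rewrite ih.
rewrite haar_lcoset// -natr1 EFinD ge0_muleDl ?lee_fin//.
by rewrite mul1e addeC.
Qed.

End Haar.

Section SmallSubgroups.
Variables (R : realType) (G : groupType) (K : topGroupType) (iota : G -> K).
Variable nu : probability (borel_type K) R.
Hypothesis G_infinite : infinite_set [set: G].
Hypotheses (cK : compact [set: K]) (hK : hausdorff_space K)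
  (zK : zero_dimensional K).
Hypotheses (iota_inj : injective iota) (iotaM : {morph iota : x y / (x * y)%g})
  (iota_dense : dense (range iota)).
Hypothesis nu_haar : haar_probability nu.
Implicit Types (H W M : set K) (s : seq G).

Lemma iota1 : iota 1%g = 1%g.
Proof. by apply: (mulgI (iota 1%g)); rewrite -iotaM !mulg1. Qed.

Lemma iotaV x : iota x^-1%g = (iota x)^-1%g.
Proof. by apply: (mulgI (iota x)); rewrite -iotaM !mulgV iota1. Qed.

Lemma denseP (U : set K) : open U -> U !=set0 -> exists g, U (iota g).
Proof.
by move=> oU U0; have [x [Ux [g _ gx]]] := iota_dense U0 oU; exists g; rewrite gx.
Qed.

(** As [G] is infinite, [K] contains more than [eps^-1] points. A subgroup avoiding their finitely
    many nontrivial quotients has that many disjoint cosets. *)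
Lemma haar_small (eps : R) : 0 < eps ->
  exists2 N : set K, nbhs (1%g : K) N & forall H, open_normal H -> H `<=` N -> (nu H < eps%:E)%E.
Proof.
move=> eps0.
have [n nP] : exists n : nat, eps^-1 < n%:R.
  by exists (Num.truncn eps^-1).+1; exact: truncnS_gt.
have [B _ Bn] := infinite_set_fset n G_infinite.
pose t := [seq iota g | g <- B].
have ut : uniq t by rewrite map_inj_uniq ?fset_uniq.
have nN : \forall x \near (1%g : K),
    forall q, q \in [seq (x, y) | x <- t, y <- t] ->
    q.1 <> q.2 -> x <> (q.1^-1 * q.2)%g.
  apply: near_all_seq => -[x y] _ /=.
  have [<-|xy] := eqVneq x y; first by apply: filterE.
  apply: filterS (near_neq hK (_ : 1%g <> (x^-1 * y)%g)) => // e.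
  by move/eqP: xy; apply; rewrite -[y](mulVKg x) -e mulg1.
exists [set x : K | forall q, q \in [seq (x, y) | x <- t, y <- t] ->
    q.1 <> q.2 -> x <> (q.1^-1 * q.2)%g] => //.
move=> H [oH sH _] HN.
have : ((size t)%:R%:E * nu H <= 1)%E.
  apply: haar_disjoint_lcosets => // x y xt yt Hxy.
  apply: contrapT => xy.
  by apply: (HN _ Hxy (x, y) _ xy) => //; apply/allpairsP; exists (x, y).
have fH : nu H \is a fin_num by exact: borel_open_fin_num.
rewrite -(fineK fH) size_map -[size B]/(#|` B|)%fset.
rewrite -EFinM lee_fin lte_fin => h.
have n1 : (n%:R : R) <= #|` B|%fset%:R by rewrite ler_nat Bn.
rewrite ltNge; apply/negP => eH.
have : 1 < n%:R * eps by rewrite -ltr_pdivrMr// mul1r.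
rewrite ltNge; apply/negP; rewrite negbK; apply: le_trans h.
by rewrite ler_pM// ltW.
Qed.

Lemma haar_point (x : K) : nu [set x] = 0%E.
Proof.
have mx := borel_closed (@closed_point _ hK x).
apply/eqP; rewrite eq_le measure_ge0 andbT; apply/lee_addgt0Pr => eps eps0.
have [N nN NH] := haar_small eps0.
have [H onH HN] := open_normal_nbhs cK hK zK nN.
case: (onH) => oH sH _.
rewrite add0e (le_trans _ (ltW (NH _ onH HN)))//.
rewrite -(haar_lcoset nu_haar x oH); apply: le_measure; rewrite ?inE//.
  exact: (borel_open (lcoset_open x oH)).
by move=> _ ->; exact: lcoset_refl.
Qed.

(** Points are null sets, so a sequence cannot exhaust [K]. Applied to an enumeration of the image
    of [G], this supplies the point [p]. *)
Lemma countable_not_dense (e : nat -> K) : exists p, forall n, e n <> p.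
Proof.
apply: contrapT => noP.
have eT : [set: K] = \bigcup_n [set e n].
  apply/seteqP; split=> // x _; apply: contrapT => nx; apply: noP; exists x => n ex.
  by apply: nx; exists n.
have : (nu [set: K] <= 0)%E.
  rewrite eT.
  apply: (@le_trans _ _ (\sum_(n <oo) nu [set e n])%E).
    apply: measure_sigma_subadditive => // [n|].
      exact: (borel_closed (@closed_point K hK (e n))).
    by rewrite -eT; exact: measurableT.
  by rewrite eseries0// => n _ _; exact: haar_point.
by rewrite probability_setT lee_fin ler10.
Qed.

End SmallSubgroups.

(** * The tower of marks *)

Section TowerStep.
Variables (R : realType) (G : groupType) (K : topGroupType) (iota : G -> K).
Variable nu : probability (borel_type K) R.
Hypothesis G_infinite : infinite_set [set: G].
Hypotheses (cK : compact [set: K]) (hK : hausdorff_space K)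
  (zK : zero_dimensional K).
Hypotheses (iota_inj : injective iota) (iotaM : {morph iota : x y / (x * y)%g})
  (iota_dense : dense (range iota)).
Hypothesis nu_haar : haar_probability nu.
Implicit Types (H W M : set K) (s : seq G).

Variable p : K.
Hypothesis p_iota : forall g, iota g <> p.

Definition inv_set W : set K := [set w | W w^-1%g].

(* The measure of the inverse is what counts: [y] has a hole at the identity iff
   [y^-1] is not colored. *)
Definition admissible W :=
  [/\ clopen W, ~ W p & (nu (inv_set W) < 2^-1%:E)%E].

Definition fatten W s H :=
  W `|` [set w | exists2 q, q \in s & lcoset (iota q) H w].

Lemma fatten_cons W q s H : fatten W (q :: s) H = fatten W s H `|` lcoset (iota q) H.
Proof.
apply/seteqP; split=> w.
  case=> [Ww|[r]]; first by left; left.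
  by rewrite inE => /predU1P[->|rs] rw; [right | left; right; exists r].
move=> [[Ww|[r rs rw]]|qw]; [by left | right | right].
  by exists r => //; rewrite inE rs orbT.
by exists q => //; rewrite mem_head.
Qed.

Lemma fatten_nil W H : fatten W [::] H = W.
Proof. by apply/seteqP; split=> w; [case=> // -[] | left]. Qed.

Lemma fatten_clopen W s H : open_normal H -> clopen W -> clopen (fatten W s H).
Proof.
move=> [oH sH _] clW; elim: s => [|q s ih]; first by rewrite fatten_nil.
by rewrite fatten_cons; apply: clopenU => //; exact: lcoset_clopen.
Qed.

Lemma inv_set_open W : open W -> open (inv_set W).
Proof.
move=> oW; apply: (open_comp (f := fun x : K => x^-1%g)) => // x _.
exact: invg_continuous.
Qed.

(** Normality turns the inverse, a right coset, back into a left coset, whose Haar measure is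
    known. *)
Lemma inv_set_lcoset a H : open_normal H -> inv_set (lcoset a H) = lcoset a^-1%g H.
Proof.
move=> [_ [_ _ HV] nH]; apply/seteqP; split=> w; rewrite /inv_set /lcoset/=.
  by move/HV/(nH a); rewrite invgM !invgK mulgA mulgK.
by move/HV/(nH a^-1%g); rewrite invgM !invgK mulgA mulgVK.
Qed.

Lemma fatten_measure W s H : open_normal H -> clopen W ->
  (nu (inv_set (fatten W s H)) <= nu (inv_set W) + (size s)%:R%:E * nu H)%E.
Proof.
move=> onH clW; elim: s => [|q s ih]; first by rewrite fatten_nil mul0e adde0.
case: (onH) => oH sH _.
rewrite fatten_cons /= -natr1 EFinD ge0_muleDl ?lee_fin// mul1e addeA.
have oW : open (fatten W s H) by case: (fatten_clopen s onH clW).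
have /le_trans := borel_openU2 nu (inv_set_open oW)
  (inv_set_open (lcoset_open (iota q) oH)).
apply; rewrite inv_set_lcoset// haar_lcoset//.
by rewrite leeD2r.
Qed.

(** The strict bound on [W] leaves room for [size s] further cosets once [H] is small, and a small
    [H] keeps [p] out of them because [p] is not in the image of [G]. *)
Lemma fatten_admissible W s (N : set K) : nbhs (1%g : K) N -> admissible W ->
  exists2 H, open_normal H & H `<=` N /\ admissible (fatten W s H).
Proof.
move=> nN [clW Wp nuW].
have fW : nu (inv_set W) \is a fin_num.
  by apply: borel_open_fin_num; apply: inv_set_open; case: clW.
(* The gap to one half is divided by [(size s).+1], which is nonzero even for an empty [s]. *)
have eps0 : 0 < (2^-1 - fine (nu (inv_set W))) / (size s).+1%:R.
  by rewrite divr_gt0// subr_gt0 -lte_fin fineK.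
have [N' nN' N'H] := haar_small G_infinite hK iota_inj nu_haar eps0.
have pN : \forall x \near (1%g : K), forall q, q \in s -> x <> ((iota q)^-1 * p)%g.
  apply: near_all_seq => q _; apply: near_neq => // e; apply: (p_iota (g := q)).
  by rewrite -[p](mulVKg (iota q)) -e mulg1.
have [H onH HN] := open_normal_nbhs cK hK zK (filterI nN (filterI nN' pN)).
exists H => //; split; first by move=> x /HN[].
split; first exact: fatten_clopen.
  by move=> [//|[q qs /HN[_ [_ /(_ _ qs)]]]].
apply: le_lt_trans (fatten_measure s onH clW) _.
have /N'H : H `<=` N' by move=> x /HN[_ []].
move=> /(_ onH).
have fH : nu H \is a fin_num by apply: borel_open_fin_num; case: onH.
rewrite -(fineK fH) -(fineK fW) -EFinM -EFinD !lte_fin fineK// ltr_pdivlMr//.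
move=> h; rewrite -ltrBrDl; apply: le_lt_trans h.
by rewrite mulrC ler_wpM2l ?ler_nat ?fine_ge0.
Qed.

(** If part of [O] is uncovered, two distinct points [iota a] and [iota b] of it carry small cosets:
    the first becomes the mark, the second the blank [Z]. The new set absorbs both, the translates
    of the mark by [E], and [iota g]. If [O] is already covered, the mark is empty. *)
Lemma tower_step W (O : set K) (E : seq G) g : admissible W -> open O ->
  1%g \in E ->
  exists WM : set K * set K,
  [/\ admissible WM.1, W `<=` WM.1 /\ WM.1 (iota g),
      clopen WM.2 /\ WM.2 `<=` O /\ (forall w, WM.2 w -> ~ W w),
      (forall w e, WM.2 w -> e \in E -> WM.1 (w * iota e)%g) /\
      (forall w e, WM.2 w -> WM.2 (w * iota e)%g -> e \in E -> e = 1%g) &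
      ~ (O `<=` W) -> WM.2 !=set0 /\ exists Z : set K,
        [/\ open Z, Z !=set0, Z `<=` O, Z `<=` WM.1 &
            forall w, Z w -> ~ W w /\ ~ WM.2 w]].
Proof.
move=> aW oO E1.
have [OW|OW] := pselect (O `<=` W).
  have [H onH [_ aH]] := fatten_admissible [:: g] filterT aW.
  exists (fatten W [:: g] H, set0); split=> //=.
    split=> [w Ww|]; first by left.
    by right; exists g; [rewrite mem_head | apply: lcoset_refl; case: onH].
  by split; [exact: clopen0 | split=> w []].
case: (aW) => [[oW cW] Wp nuW].
pose D := O `&` ~` W.
have oD : open D by apply: openI => //; exact: closed_openC.
have D0 : D !=set0.
  by have /existsNP[w /not_implyP[Ow nWw]] := OW; exists w.
have [a Da] := denseP iota_dense oD D0.
(* Were [D] only the point [iota a], its translate to [p] would be an open singleton, and density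
   would put [p] in the image of [G]. *)
have [b [Db ba]] : exists b, D (iota b) /\ iota b <> iota a.
  apply: contrapT => nob.
  have : exists c, D (iota a * p^-1 * iota c)%g.
    apply: (denseP iota_dense (open_mulgl _ oD)).
    by exists p; rewrite /= mulgVK.
  move=> [c Dc].
  pose D' := D `&` [set~ iota a].
  have oD' : open D'.
    by apply: openI => //; exact/closed_openC/closed_point.
  have [D'0|D'0] := pselect (D' !=set0).
    have [b [Db ba]] := denseP iota_dense oD' D'0.
    by apply: nob; exists b.
  apply: (p_iota (g := c)); apply: contrapT => cp; apply: D'0.
  exists (iota a * p^-1 * iota c)%g; split=> //= e; apply: cp.
  have := congr1 (fun x => p * ((iota a)^-1 * x))%g e.
  by rewrite -mulgA mulKg mulVKg mulVg mulg1.
pose s := [seq (a * e)%g | e <- E] ++ [:: b; g].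
have nDa : \forall x \near (1%g : K), D (iota a * x)%g.
  by apply: near_mulgl; rewrite mulg1; exact: open_nbhs_nbhs.
have nDb : \forall x \near (1%g : K), D (iota b * x)%g.
  by apply: near_mulgl; rewrite mulg1; exact: open_nbhs_nbhs.
have nab : \forall x \near (1%g : K), x <> ((iota a)^-1 * iota b)%g.
  apply: near_neq => // e; apply: ba.
  by rewrite -[iota b](mulVKg (iota a)) -e mulg1.
(* Avoiding the nontrivial elements of [E] makes the mark disjoint from its own translates by
   them. *)
have nE : \forall x \near (1%g : K), forall e, e \in E -> e <> 1%g -> x <> iota e.
  apply: near_all_seq => e _; have [->|e1] := eqVneq e 1%g; first exact: filterE.
  apply: filterS (near_neq hK (_ : 1%g <> iota e)) => //.
  by rewrite -(iota1 iotaM) => /iota_inj /esym /eqP; exact/negP.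
have [H onH [HN aH]] := fatten_admissible s
  (filterI nDa (filterI nDb (filterI nab nE))) aW.
case: (onH) => oH sH nH; case: (sH) => H1 HM HV.
have aD w : lcoset (iota a) H w -> D w.
  by move=> /HN[]; rewrite /= mulVKg.
have bD w : lcoset (iota b) H w -> D w.
  by move=> /HN[_ []]; rewrite /= mulVKg.
exists (fatten W s H, lcoset (iota a) H); split=> //=.
- split=> [w Ww|]; first by left.
  by right; exists g; [rewrite mem_cat !inE eqxx !orbT | exact: lcoset_refl].
- by split; [exact: lcoset_clopen | split=> w /aD[]].
- split=> [w e aw eE|w e aw awe eE].
    right; exists (a * e)%g; first by rewrite mem_cat map_f.
    have := nH (iota e)^-1%g _ aw.
    by rewrite /lcoset/= invgK iotaM invgM !mulgA.
  apply: contrapT => e1.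
  have : H (iota e).
    have -> : iota e = (((iota a)^-1 * w)^-1 * ((iota a)^-1 * (w * iota e)))%g.
      by rewrite invgM invgK !mulgA mulgK mulVg mul1g.
    by apply: HM => //; exact: HV.
  by move=> /HN[_ [_ [_ /(_ e eE e1)]]].
- move=> _; split; first by exists (iota a); exact: lcoset_refl.
  exists (lcoset (iota b) H); split.
  + exact: lcoset_open.
  + by exists (iota b); exact: lcoset_refl.
  + by move=> w /bD[].
  + move=> w bw; right; exists b => //.
    by rewrite mem_cat !inE eqxx !orbT.
  + move=> w bw; split; first by case: (bD _ bw).
    move=> aw.
    have : H ((iota a)^-1 * iota b)%g.
      have -> : ((iota a)^-1 * iota b = ((iota a)^-1 * w) * ((iota b)^-1 * w)^-1)%g.
        by rewrite invgM invgK mulgA mulgK.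
      by apply: HM => //; exact: HV.
    by move=> /HN[_ [_ []]].
Qed.

End TowerStep.

(** * Finite exhaustion of [G] and a basis at the identity of [K] *)

Section Enumeration.
Variables (G : groupType) (e : nat -> G).
Hypothesis e_surj : forall g, exists n, e n = g.

(** Finite symmetric sets increasing to [G]. Symmetry allows two marks to be compared in either
    order. *)
Definition sym_enum n : seq G :=
  (1%g :: mkseq e n.+1) ++ [seq x^-1%g | x <- mkseq e n.+1].

Lemma mem_mkseq n g : reflect (exists2 i, (i < n)%N & g = e i) (g \in mkseq e n).
Proof.
apply: (iffP mapP) => -[i hi ->]; exists i => //; move: hi; rewrite mem_iota//.
Qed.

Lemma mem_sym_enum n g : (g \in sym_enum n) =
  [|| g == 1%g, g \in mkseq e n.+1 | g^-1%g \in mkseq e n.+1].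
Proof.
rewrite /sym_enum mem_cat in_cons -orbA; congr [|| _, _ | _].
by rewrite -{1}[g]invgK mem_map//; exact: invg_inj.
Qed.

Lemma sym_enum1 n : 1%g \in sym_enum n.
Proof. by rewrite mem_sym_enum eqxx. Qed.

Lemma sym_enumV n g : g \in sym_enum n -> g^-1%g \in sym_enum n.
Proof. by rewrite !mem_sym_enum invgK invg_eq1 => /or3P[]->; rewrite ?orbT. Qed.

Lemma sym_enum_mono m n : (m <= n)%N -> {subset sym_enum m <= sym_enum n}.
Proof.
move=> mn g.
have sub x : x \in mkseq e m.+1 -> x \in mkseq e n.+1.
  by move=> /mem_mkseq[i im ->]; apply/mem_mkseq; exists i => //; exact: leq_trans im _.
by rewrite !mem_sym_enum => /or3P[->|/sub->|/sub->]; rewrite ?orbT.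
Qed.

Lemma sym_enum_ex g : exists n, g \in sym_enum n.
Proof.
have [n <-] := e_surj g; exists n; rewrite mem_sym_enum.
by apply/or3P/Or32/mem_mkseq; exists n.
Qed.

Lemma sym_enum_ex_seq (s : seq G) : exists n, {subset s <= sym_enum n}.
Proof.
elim: s => [|g s [n sn]]; first by exists 0%N.
have [m gm] := sym_enum_ex g; exists (maxn m n) => x; rewrite inE => /predU1P[->|/sn].
  by apply: sym_enum_mono gm; exact: leq_maxl.
by apply: sym_enum_mono; exact: leq_maxr.
Qed.

End Enumeration.

(** Finite intersections of open normal subgroups inside balls of radius [n.+1^-1] make the basis
    decreasing. *)
Lemma open_normal_basis (R : realType) (K : topGroupType) :
  compact [set: K] -> hausdorff_space K -> zero_dimensional K -> metrizable R K ->
  exists Hs : nat -> set K,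
    [/\ forall n, open_normal (Hs n),
        forall m n, (m <= n)%N -> Hs n `<=` Hs m &
        forall O : set K, nbhs (1%g : K) O -> exists n, Hs n `<=` O].
Proof.
move=> cK hK zK [d dP].
have h n : exists H : set K, open_normal H /\ H `<=` [set y | d 1%g y < n.+1%:R^-1].
  have n0 : 0 < n.+1%:R^-1 :> R by rewrite invr_gt0.
  have [H ? ?] := open_normal_nbhs cK hK zK (compatible_metric_ball dP 1%g n0).
  by exists H.
have {h}[H HP] := choice h.
pose Hs n := [set x | forall i, i \in mkseq id n.+1 -> H i x].
exists Hs; split.
- move=> n; split.
  + apply: subgroup_open.
      by split=> [|x y hx hy|x hx] i iN; have [[_ [H1 HM HV] _] _] := HP i;
        [exact: H1 | exact: HM (hx _ iN) (hy _ iN) | exact: HV (hx _ iN)].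
    apply: near_all_seq => i _; have [[oH [H1 _ _] _] _] := HP i.
    exact: open_nbhs_nbhs.
  + by split=> [|x y hx hy|x hx] i iN; have [[_ [H1 HM HV] _] _] := HP i;
      [exact: H1 | exact: HM (hx _ iN) (hy _ iN) | exact: HV (hx _ iN)].
  + by move=> g x hx i iN; have [[_ _ nH] _] := HP i; exact: nH (hx _ iN).
- move=> m n mn x hx i; rewrite /mkseq map_id mem_iota add0n => /= im.
  by apply: hx; rewrite /mkseq map_id mem_iota add0n /= (leq_trans im).
- move=> O /(let: And4 _ _ _ dN := dP in dN 1%g O).1 [r r0 rO].
  exists (Num.truncn r^-1) => x /(_ (Num.truncn r^-1)).
  rewrite /mkseq map_id mem_iota add0n ltnSn => /(_ isT) Hx.
  have [_ /(_ _ Hx)] := HP (Num.truncn r^-1).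
  move=> /= dx; apply: rO => /=; apply: (lt_le_trans dx).
  by rewrite -[leRHS]invrK lef_pV2 ?posrE ?invr_gt0// ltW// truncnS_gt.
Qed.

Section TowerSequence.
Variables (R : realType) (G : groupType) (K : topGroupType) (iota : G -> K).
Variable nu : probability (borel_type K) R.
Variables (e : nat -> G) (p : K) (Hs : nat -> set K).

(* Even steps aim at every coset [iota g Hs k] in turn, odd steps at the
   shrinking neighborhoods of [p]. *)
Definition target n : set K :=
  if odd n then lcoset p (Hs n)
  else if choice.unpickle n./2 is Some (i, k) then lcoset (iota (e i)) (Hs k) else setT.

(** [tower_mark_translate] covers the early translates of a mark at once, so no later mark meets
    them; [tower_mark_separated] treats two points of the same mark. A blank is covered without
    being marked, so no later step can mark it. *)
Record tower (W M : nat -> set K) : Prop := Tower {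
  tower_0 : W 0%N = set0;
  tower_admissible : forall n, admissible nu p (W n);
  tower_sub : forall n, W n `<=` W n.+1;
  tower_iota : forall n, W n.+1 (iota (e n));
  tower_mark_clopen : forall n, clopen (M n);
  tower_mark_target : forall n, M n `<=` target n;
  tower_mark_new : forall n w, M n w -> ~ W n w;
  tower_mark_translate : forall n w g,
    M n w -> g \in sym_enum e n -> W n.+1 (w * iota g)%g;
  tower_mark_separated : forall n w g,
    M n w -> M n (w * iota g)%g -> g \in sym_enum e n -> g = 1%g;
  tower_mark_ex : forall n, ~ (target n `<=` W n) -> M n !=set0;
  tower_blank_ex : forall n, ~ (target n `<=` W n) -> exists Z : set K,
    [/\ open Z, Z !=set0, Z `<=` target n, Z `<=` W n.+1 &
      forall w, Z w -> ~ W n w /\ ~ M n w]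
}.

Hypothesis G_infinite : infinite_set [set: G].
Hypotheses (cK : compact [set: K]) (hK : hausdorff_space K)
  (zK : zero_dimensional K).
Hypotheses (iota_inj : injective iota) (iotaM : {morph iota : x y / (x * y)%g})
  (iota_dense : dense (range iota)).
Hypothesis nu_haar : haar_probability nu.
Hypothesis p_iota : forall g, iota g <> p.
Hypothesis HsP : forall n, open_normal (Hs n).

Lemma target_open n : open (target n).
Proof.
rewrite /target; case: (odd n); first by apply: lcoset_open; case: (HsP n).
case: (choice.unpickle n./2 : option (nat * nat)) => [[i k]|]; last exact: openT.
by apply: lcoset_open; case: (HsP k).
Qed.

Lemma tower_ex : exists W M, tower W M.
Proof.
(* Admissibility is a premise of the conclusion, so the step is total and choice yields a step
   function. *)
have step (nW : nat * set K) : exists WM : set K * set K, admissible nu p nW.2 ->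
  [/\ admissible nu p WM.1, nW.2 `<=` WM.1 /\ WM.1 (iota (e nW.1)),
      clopen WM.2 /\ WM.2 `<=` target nW.1 /\ (forall w, WM.2 w -> ~ nW.2 w),
      (forall w g, WM.2 w -> g \in sym_enum e nW.1 -> WM.1 (w * iota g)%g) /\
      (forall w g, WM.2 w -> WM.2 (w * iota g)%g -> g \in sym_enum e nW.1 ->
         g = 1%g) &
      ~ (target nW.1 `<=` nW.2) -> WM.2 !=set0 /\ exists Z : set K,
        [/\ open Z, Z !=set0, Z `<=` target nW.1, Z `<=` WM.1 &
            forall w, Z w -> ~ nW.2 w /\ ~ WM.2 w]].
  have [aW|] := pselect (admissible nu p nW.2); last by exists (set0, set0).
  have [WM WMP] := tower_step G_infinite cK hK zK iota_inj iotaM iota_dense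
    nu_haar p_iota (e nW.1) aW (target_open nW.1) (sym_enum1 e nW.1).
  by exists WM.
have {step}[F FP] := choice step.
pose W := fix W n : set K := if n is m.+1 then (F (m, W m)).1 else set0.
pose M n := (F (n, W n)).2.
have aW n : admissible nu p (W n).
  elim: n => [|n ih]; last by case: (FP (n, W n) ih).
  split=> //; first exact: clopen0.
  have -> : inv_set set0 = set0 :> set K by apply/seteqP; split.
  by rewrite measure0 lte_fin invr_gt0.
exists W, M; split=> // [n|n|n|n|n|n|n|n|n]; have := FP (n, W n) (aW n).
- by case=> _ [].
- by case=> _ [].
- by case=> _ _ [].
- by case=> _ _ [_ []].
- by case=> _ _ [_ [_ h]] _ _; exact: h.
- by case=> _ _ _ [h _] _; exact: h.
- by case=> _ _ _ [_ h] _; exact: h.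
- by case=> _ _ _ _ h /h[].
- by case=> _ _ _ _ h /h[].
Qed.

End TowerSequence.

(** * The coloring and its accumulation outside the colored set *)

Section Coloring.
Variables (R : realType) (G : groupType) (K : topGroupType) (iota : G -> K).
Variable nu : probability (borel_type K) R.
Variables (e : nat -> G) (p : K) (Hs : nat -> set K).
Hypothesis e_surj : forall g, exists n, e n = g.
Hypotheses (iotaM : {morph iota : x y / (x * y)%g})
  (iota_dense : dense (range iota)).
Hypothesis hK : hausdorff_space K.
Hypothesis HsP : forall n, open_normal (Hs n).
Hypothesis Hs_anti : forall m n, (m <= n)%N -> Hs n `<=` Hs m.
Hypothesis Hs_basis :
  forall O : set K, nbhs (1%g : K) O -> exists n, Hs n `<=` O.
Variables W M : nat -> set K.
Hypothesis T : tower iota nu e p Hs W M.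

(** The marks are disjoint ([mark_inj]), so the chosen index is the only one. [None] is the value
    both on blanks and at the points outside [colored]. *)
Definition color (w : K) : option bool :=
  if pselect (exists n, M n w) is left h then Some (odd (projT1 (cid h))) else None.

Definition colored : set K := [set w | exists n, W n w].

(** The part of the coloring known at level [n]. Unlike [color] it is locally constant on all of
    [K], hence has an open normal group of periods; the outer [None] tells the holes of level [n]
    from the blanks. *)
Definition color_upto n (w : K) : option (option bool) :=
  if pselect (W n w) is left _ then Some (color w) else None.

Lemma tower_mono m n : (m <= n)%N -> W m `<=` W n.
Proof.
move=> /subnK <-; elim: (n - m)%N => [|k ih] w Wm; first by rewrite add0n.
by rewrite addSn; apply: (tower_sub T); exact: ih.
Qed.

Lemma tower_open n : open (W n).
Proof. by have [[]] := tower_admissible T n. Qed.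

Lemma tower_not_p n : ~ W n p.
Proof. by have [] := tower_admissible T n. Qed.

Lemma mark_sub n : M n `<=` W n.+1.
Proof.
move=> w /(tower_mark_translate T)/(_ (sym_enum1 e n)).
by rewrite (iota1 iotaM) mulg1.
Qed.

Lemma mark_late n m w : M n w -> ~ W m w -> (m <= n)%N.
Proof.
move=> Mw nWw; rewrite leqNgt; apply/negP => nm; apply: nWw.
exact: tower_mono nm _ (mark_sub Mw).
Qed.

Lemma mark_inj m n w : M m w -> M n w -> m = n.
Proof.
move=> Mm Mn; apply/eqP; rewrite eqn_leq.
by rewrite (mark_late Mn (tower_mark_new T Mm)) (mark_late Mm (tower_mark_new T Mn)).
Qed.

Lemma colorP n w : M n w -> color w = Some (odd n).
Proof.
move=> Mw; rewrite /color; case: pselect => [h|[]]; last by exists n.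
by case: (cid h) => m Mm /=; rewrite (mark_inj Mm Mw).
Qed.

Lemma color_mark w b : color w = Some b -> exists2 n, M n w & odd n = b.
Proof. by rewrite /color; case: pselect => // h [<-]; case: (cid h) => n Mn; exists n. Qed.

Lemma color_None w : (forall n, ~ M n w) -> color w = None.
Proof.
by move=> nM; rewrite /color; case: pselect => // h; exfalso; case: h => n /nM.
Qed.

Lemma color_neq_None w : color w <> None -> exists n, M n w.
Proof. by rewrite /color; case: pselect. Qed.

Lemma color_uptoP n w : W n w -> color_upto n w = Some (color w).
Proof. by rewrite /color_upto; case: pselect. Qed.

Lemma color_uptoN n w : ~ W n w -> color_upto n w = None.
Proof. by rewrite /color_upto; case: pselect. Qed.

Lemma color_upto_eq n w w' : color_upto n w = color_upto n w' ->
  (W n w <-> W n w') /\ (W n w -> color w = color w').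
Proof.
have [Ww|nWw] := pselect (W n w); have [Ww'|nWw'] := pselect (W n w').
- by rewrite !color_uptoP// => -[].
- by rewrite color_uptoP// color_uptoN.
- by rewrite color_uptoN// color_uptoP.
- by [].
Qed.

Lemma color_separated n w g : color w <> None -> color (w * iota g)%g <> None ->
  ~ W n w -> ~ W n (w * iota g)%g -> g \in sym_enum e n -> g = 1%g.
Proof.
move=> /color_neq_None[i Mi] /color_neq_None[j Mj] nWw nWwg gn.
have ni := mark_late Mi nWw; have nj := mark_late Mj nWwg.
have [ij|ji|ij] := ltngtP i j.
- have /(tower_mono ij) := tower_mark_translate T Mi (sym_enum_mono ni gn).
  by move=> /(tower_mark_new T Mj).
- have := tower_mark_translate T Mj (sym_enumV (sym_enum_mono nj gn)).
  rewrite -mulgA -iotaM mulgV (iota1 iotaM) mulg1 => /(tower_mono ji).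
  by move=> /(tower_mark_new T Mi).
- rewrite -ij in Mj.
  exact: (tower_mark_separated T Mi Mj (sym_enum_mono ni gn)).
Qed.

(** On the clopen set [W n.+1] minus [W n] the only possible mark is [M n], which is itself
    clopen. *)
Lemma color_locally_constant n w : W n w -> \forall w' \near w, color w' = color w.
Proof.
elim: n w => [|n ih] w Ww.
  by move: Ww; rewrite (tower_0 T).
have [/ih//|nWw] := pselect (W n w).
have nW : \forall w' \near w, W n.+1 w' /\ ~ W n w'.
  apply: open_nbhs_nbhs; split=> //; apply: openI; first exact: tower_open.
  by apply: closed_openC; have [[_ cW] _ _] := tower_admissible T n.
have nM := clopen_locally_constant (tower_mark_clopen T n) w.
have colE w' : W n.+1 w' -> ~ W n w' -> color w' = if `[< M n w' >] then Some (odd n) else None.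
  move=> Ww' nWw'; case: asboolP => [/colorP//|nM'].
  apply: color_None => i Mi; have ni := mark_late Mi nWw'.
  have : (i < n.+1)%N by rewrite ltnNge; apply/negP => /tower_mono/(_ _ Ww')/(tower_mark_new T Mi).
  rewrite ltnS => iN; apply: nM'.
  by rewrite (_ : n = i)//; apply/eqP; rewrite eqn_leq ni iN.
by apply: filterS2 nW nM => w' [Ww' nWw'] MM; rewrite !colE// MM.
Qed.

Lemma color_upto_locally_constant n : locally_constant (color_upto n).
Proof.
move=> w; have [clW _ _] := tower_admissible T n.
have := clopen_locally_constant clW w.
have [Ww|nWw] := pselect (W n w).
  apply: filterS2 (color_locally_constant Ww) => w' cw' WW'.
  by rewrite !color_uptoP ?WW'// cw'.
by apply: filterS => w' WW'; rewrite !color_uptoN ?WW'.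
Qed.

Lemma colored_dense : dense colored.
Proof.
move=> O [x Ox] oO; have [g Og] := denseP iota_dense oO (ex_intro _ x Ox).
exists (iota g); split=> //; have [n <-] := e_surj g.
by exists n.+1; exact: (tower_iota T).
Qed.

Lemma target_even i k :
  target iota e p Hs (choice.pickle (i, k)).*2 = lcoset (iota (e i)) (Hs k).
Proof. by rewrite /target odd_double doubleK choice.pickleK. Qed.

Lemma lcoset_eq (a b : K) (H : set K) : subgroup H -> lcoset a H b -> lcoset a H = lcoset b H.
Proof.
move=> [_ HM HV] ab; apply/seteqP; split=> w; rewrite /lcoset/=.
  have -> : (b^-1 * w = (a^-1 * b)^-1 * (a^-1 * w))%g.
    by rewrite invgM invgK mulgA mulgK.
  by apply: HM; exact: HV.
have -> : (a^-1 * w = (a^-1 * b) * (b^-1 * w))%g by rewrite mulgA mulgK.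
exact: HM.
Qed.

Lemma lcoset_basis d (O : set K) : nbhs d O -> exists k, lcoset d (Hs k) `<=` O.
Proof.
rewrite -{1}[d]mulg1 => /near_mulgl/Hs_basis[k HO]; exists k => w /HO /=.
by rewrite mulVKg.
Qed.

(* Hence [color] has no limit at the points outside [colored]. *)
Lemma uncolored_accumulation d (O : set K) : ~ colored d -> nbhs d O ->
  exists n,
    (exists Z : set K, [/\ open Z, Z !=set0, Z `<=` O, Z `<=` W n &
       forall w, Z w -> color w = Some false]) /\
    (exists Z : set K, [/\ open Z, Z !=set0, Z `<=` O, Z `<=` W n &
       forall w, Z w -> color w = None]).
Proof.
move=> nd /lcoset_basis[k HO].
have [oH sH _] := HsP k.
have [g gd] : exists g, lcoset d (Hs k) (iota g).
  by apply: (denseP iota_dense (lcoset_open d oH)); exists d; exact: lcoset_refl.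
have [i ig] := e_surj g.
(* Step [n] is the even one aimed at the coset of [d]. This coset contains the uncolored [d], so it
   is not inside [W n] and receives a mark and a blank. *)
pose n := (choice.pickle (i, k)).*2; exists n.+1.
have tn : target iota e p Hs n = lcoset d (Hs k).
  by rewrite target_even ig -(lcoset_eq sH gd).
have nt : ~ (target iota e p Hs n `<=` W n).
  by rewrite tn => /(_ d (lcoset_refl d sH)) Wd; apply: nd; exists n.
split.
  exists (M n); split.
  - by case: (tower_mark_clopen T n).
  - exact: (tower_mark_ex T nt).
  - by apply: subset_trans HO; rewrite -tn; exact: (tower_mark_target T).
  - exact: mark_sub.
  - by move=> w /colorP ->; rewrite odd_double.
have [Z [oZ Z0 Zt ZW Zn]] := tower_blank_ex T nt; exists Z; split=> //.
  by apply: subset_trans HO; rewrite -tn.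
(* The blank lies in [W n.+1] but outside [W n] and [M n], so no mark, earlier or later, meets
   it. *)
move=> w Zw; have [nWw nMw] := Zn _ Zw; apply: color_None => j Mj.
have := mark_late Mj nWw; rewrite leq_eqVlt => /predU1P[nj|nj].
  by apply: nMw; rewrite nj.
by apply: (tower_mark_new T Mj); apply: tower_mono nj _ _; exact: ZW.
Qed.

Lemma uncolored_p : ~ colored p.
Proof. by case=> n; exact: tower_not_p. Qed.

(** Odd steps aim at shrinking cosets of [p]; no [W n] contains [p], so each of them places a
    mark. *)
Lemma p_accumulation (O : set K) : nbhs p O ->
  exists n (Z : set K), [/\ open Z, Z !=set0, Z `<=` O, Z `<=` W n &
    forall w, Z w -> color w = Some true].
Proof.
move=> /lcoset_basis[k HO]; pose n := k.*2.+1.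
have tn : target iota e p Hs n = lcoset p (Hs n) by rewrite /target /= odd_double.
have [_ sH _] := HsP n.
have nt : ~ (target iota e p Hs n `<=` W n).
  by rewrite tn => /(_ p (lcoset_refl p sH)) Wd; exact: tower_not_p Wd.
exists n.+1, (M n); split.
- by case: (tower_mark_clopen T n).
- exact: (tower_mark_ex T nt).
- apply: subset_trans HO; apply: subset_trans (tower_mark_target T (n := n)) _.
  rewrite tn => w; apply: Hs_anti; rewrite /n -addnn.
  by rewrite -addSn leq_addl.
- exact: mark_sub.
- by move=> w /colorP ->; rewrite /= odd_double.
Qed.

(** Outside the coset of [p] by [Hs k] only odd marks of index below [k] occur, and a finite union
    of clopen sets has a locally constant indicator. Together with [p_accumulation] this singles out
    [p]. *)
Lemma color_true_locally_constant q : q <> p ->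
  \forall w \near q, (color w = Some true) = (color q = Some true).
Proof.
move=> qp.
have [k nk] : exists k, ~ lcoset p (Hs k) q.
  have [k sub] := lcoset_basis (near_neq hK (nesym qp)).
  by exists k => /sub.
have [oH sH _] := HsP k.
have trueE w : ~ lcoset p (Hs k) w ->
    (color w = Some true) = exists2 n, n \in index_iota 0 k & M n w /\ odd n.
  move=> nkw; apply/propext; split=> [/color_mark[n Mn on]|[n _ [/colorP-> ->//]]].
  exists n => //; rewrite mem_index_iota leq0n /= ltnNge; apply/negP => kn.
  apply: nkw; apply: Hs_anti kn _ _.
  by have := tower_mark_target T Mn; rewrite /target on.
have nM : \forall w \near q, forall n, n \in index_iota 0 k -> M n w = M n q.
  apply: near_all_seq => n _.
  exact: clopen_locally_constant (tower_mark_clopen T n) q.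
have nC : \forall w \near q, ~ lcoset p (Hs k) w.
  apply: open_nbhs_nbhs; split=> //; apply: closed_openC.
  by case: (lcoset_clopen p oH sH).
apply: filterS2 nM nC => w MM nw; rewrite !trueE//; apply/propext.
by split=> -[n nk' [Mn on]]; exists n => //; split=> //; rewrite ?MM// -MM.
Qed.

End Coloring.

(** * Subshifts and densities *)

Section Configurations.
Variables (G : groupType) (S : finType).

Lemma config_cylinder_nbhs (x : config G S) (s : seq G) :
  nbhs x [set z : config G S | forall g, g \in s -> z g = x g].
Proof.
apply: (near_all_seq (nbhs_filter x) (P := fun g (z : config G S) => z g = x g)) => g _.
exact: (@proj_continuous G (fun _ => discrete_topology S) g x _
  (discrete_set1 (x g : discrete_topology S))).
Qed.

Lemma config_nbhsP (x : config G S) (A : set (config G S)) :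
  nbhs x A <-> exists s : seq G, forall z, (forall g, g \in s -> z g = x g) -> A z.
Proof.
split=> [|[s sA]]; last exact: filterS sA (config_cylinder_nbhs x s).
pose F := filter_from [set: seq G]
  (fun s => [set z : config G S | forall g, g \in s -> z g = x g]).
have FF : Filter F.
  apply: filter_from_filter; first by exists [::].
  move=> s t _ _; exists (s ++ t) => // z zst; split=> g gs; apply: zst.
    by rewrite mem_cat gs.
  by rewrite mem_cat gs orbT.
have Fx : F --> x.
  apply/cvg_sup => g A' [B [[U oU <-] /= Ux UA]].
  exists [:: g] => // z zg; apply: UA => /=.
  by rewrite (_ : z g = x g)//; apply: zg; rewrite mem_head.
by move=> /Fx[s _ sA]; exists s.
Qed.

Lemma config_compact : compact [set: config G S].
Proof.
have fS : finite_set [set: S] by exact: finite_finset.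
have cS : compact [set: discrete_topology S] by apply: finite_compact; exact: fS.
have := @tychonoff G (fun _ => discrete_topology S) (fun _ => setT) (fun _ => cS).
by congr compact; apply/seteqP; split.
Qed.

Variable eta : config G S.
Notation X := (subshift eta).

Lemma subshift_nbhsP (x : X) (A : set X) :
  nbhs x A <-> exists s : seq G, forall z : X,
    (forall g, g \in s -> set_val z g = set_val x g) -> A z.
Proof.
split=> [|[s sA]].
  rewrite nbhsE => -[U [[V oV <-] Vx] UA].
  have /config_nbhsP[s sV] : nbhs (set_val x) V by exact: open_nbhs_nbhs.
  by exists s => z zs; apply: UA; exact: sV.
have := config_cylinder_nbhs (set_val x) s.
move=> /(@initial_continuous _ _ (set_val : X -> config G S) x) h.
by apply: (@filterS X (nbhs x) (nbhs_filter x) _ _ _ h) => z; exact: sA.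
Qed.

Lemma subshift_compact : compact [set: X].
Proof.
move=> F PF _.
pose F' := [set A : set (config G S) | F (set_val @^-1` A)].
have PF' : ProperFilter F'.
  split; first by rewrite /F' /= preimage_set0; exact: filter_not_empty.
  split=> [|A B FA FB|A B AB FA].
  - exact: filterT.
  - exact: filterI.
  - by apply: filterS FA => z; exact: AB.
have [x [_ xF]] := config_compact PF' (filterT : F' setT).
have clx : closure (gorbit eta) x.
  apply: closed_closure => B nB; apply: xF nB.
  by rewrite /F' /=; apply: filterE => z; exact: set_valP.
exists (SigSub (mem_set clx)); split=> // A B FA /subshift_nbhsP[s sB].
have FA' : F' (set_val @` A) by rewrite /F' /=; apply: filterS FA => z Az; exists z.
have [_ [[z Az <-] zs]] := xF _ _ FA' (config_cylinder_nbhs x s).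
by exists z; split=> //; exact: sB.
Qed.

End Configurations.

(** The metric is the ultrametric with value [n.+1^-1], where [n] is the first coordinate at which
    the points differ. *)
Lemma coordinate_metrizable (R : realType) (X : topologicalType) (S : eqType)
    (c : X -> nat -> S) :
  (forall x z, (forall n, c x n = c z n) -> x = z) ->
  (forall (x : X) (A : set X), nbhs x A <->
     exists n, forall z, (forall i, (i <= n)%N -> c z i = c x i) -> A z) ->
  exists d : X -> X -> R, compatible_metric d /\
    forall x z n, d x z < n.+1%:R^-1 <-> forall i, (i <= n)%N -> c x i = c z i.
Proof.
move=> cinj cnb.
pose diff x z : pred nat := fun n => c x n != c z n.
pose d (x z : X) : R :=
  if pselect (exists n, diff x z n) is left h then (ex_minn h).+1%:R^-1 else 0.
have dlt x z n : d x z < n.+1%:R^-1 <-> forall i, (i <= n)%N -> c x i = c z i.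
  rewrite /d; case: pselect => [h|nh]; last first.
    split=> [_ i _|_]; last by rewrite invr_gt0.
    by apply/eqP; apply: contraT => di; case: nh; exists i.
  case: ex_minnP => m dm minm.
  rewrite ltf_pV2 ?posrE// ltr_nat ltnS; split=> [nm i iN|agr].
    apply/eqP; apply: contraT => /minm mi.
    by have := leq_trans (leq_ltn_trans iN nm) mi; rewrite ltnn.
  by rewrite ltnNge; apply/negP => /agr /eqP; apply/negP.
have d0 x z : 0 <= d x z by rewrite /d; case: pselect => // h; rewrite invr_ge0.
have dval x z : d x z = 0 \/ exists n, d x z = n.+1%:R^-1.
  by rewrite /d; case: pselect => [h|]; [right; exists (ex_minn h) | left].
have ltinv (y : R) : (forall n : nat, y < n.+1%:R^-1) -> 0 <= y -> y = 0.
  move=> yn y0; apply/eqP; rewrite eq_le y0 andbT leNgt; apply/negP => yp.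
  have := yn (Num.truncn y^-1); rewrite ltNge => /negP; apply.
  by rewrite -[leRHS]invrK lef_pV2 ?posrE ?invr_gt0// ltW// truncnS_gt.
exists d; split=> //; split.
- move=> x z; split=> [dxz|->].
    by apply: cinj => n; apply: (dlt x z n).1 => //; rewrite dxz invr_gt0.
  by apply: ltinv => // n; apply/dlt.
(* All values are zero or some [n.+1^-1], so symmetry follows from that of the agreement of
   coordinates. *)
- move=> x z; have dxz : forall n, d x z < n.+1%:R^-1 <-> d z x < n.+1%:R^-1.
    by move=> n; split=> /dlt h; apply/dlt => i /h.
  case: (dval x z) (dval z x) => [xz|[n xz]] [zx|[m zx]].
  + by rewrite xz zx.
  + by rewrite xz; apply/esym/ltinv => // n; apply/dxz; rewrite xz invr_gt0.
  + by rewrite zx; apply/ltinv => // i; apply/dxz; rewrite zx invr_gt0.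
  + rewrite xz zx; apply/eqP; rewrite eq_le !leNgt; apply/andP; split; apply/negP.
      by move=> h; have := (dxz n).2; rewrite zx xz ltxx => /(_ h).
    by move=> h; have := (dxz m).1; rewrite zx xz ltxx => /(_ h).
- move=> x y z.
  suff : d x z <= d x y \/ d x z <= d y z.
    by case=> /le_trans; apply; rewrite ?lerDl ?lerDr.
  case: (dval x z) => [->|[n xz]]; first by left.
  apply/orP; rewrite -[_ || _]negbK negb_or -!ltNge xz; apply/negP => /andP[].
  move=> /dlt xy /dlt yz; have := (dlt x z n).2.
  by rewrite xz ltxx => /(_ (fun i iN => etrans (xy i iN) (yz i iN))).
- move=> x A; rewrite cnb; split=> [[n nA]|[r r0 rA]].
    exists n.+1%:R^-1; first by rewrite invr_gt0.
    by move=> z /= /dlt xz; apply: nA => i /xz.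
  exists (Num.truncn r^-1) => z zx; apply: rA => /=.
  have : d x z < (Num.truncn r^-1).+1%:R^-1 by apply/dlt => i /zx.
  move=> /lt_le_trans; apply.
  by rewrite -[leRHS]invrK lef_pV2 ?posrE ?invr_gt0// ltW// truncnS_gt.
Qed.

(** * Density along Folner sequences *)

Section Density.
Variables (R : realType) (G : groupType) (F : nat -> {fset G}).
Hypothesis folF : folner R F.

(* Disjointness of the left translates of [B] by the [q] elements of [Q] bounds
   the density of [B] by [1/q]; the factor 2 absorbs the Folner errors. *)
Lemma folner_density (B : set G) (Q : seq G) : uniq Q -> (0 < size Q)%N ->
  (forall b b' c c', B b -> B b' -> c \in Q -> c' \in Q ->
     (c * b = c' * b')%g -> c = c') ->
  \forall n \near \oo,
    (count (fun g => `[< B g >]) (F n))%:R <= 2 / (size Q)%:R * #|` F n|%:R :> R.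
Proof.
move=> uQ Q0 sep; case: folF => F0 Fcvg.
(* Each of the [size Q] translates eventually errs by at most [1 / size Q] of [F n], so all errors
   together cost one more copy of [F n]. *)
have ev : \forall n \near \oo, forall c, c \in Q ->
    #|` symdiff (ltranslate c (F n)) (F n)|%:R / #|` F n|%:R <= (size Q)%:R^-1 :> R.
  apply: near_all_seq => c _.
  have /cvgrPdist_le/(_ (size Q)%:R^-1) := Fcvg c.
  rewrite invr_gt0 ltr0n => /(_ Q0); apply: filterS => n.
  by rewrite sub0r normrN; apply: le_trans; exact: ler_norm.
apply: filterS ev => n ev.
set Phi := F n in ev *.
have Phi0 : 0 < #|` Phi|%:R :> R by rewrite ltr0n cardfs_gt0 F0.
pose A := [fset b in Phi | `[< B b >]]%fset.
have cA : count (fun g => `[< B g >]) Phi = #|` A|.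
  rewrite -size_filter; apply/perm_size/uniq_perm.
  - by rewrite filter_uniq// fset_uniq.
  - exact: fset_uniq.
  - by move=> b; rewrite mem_filter !inE/= andbC.
(* [T] is the disjoint union of the translates of [A] by [P]; it stays in [Phi] up to the Folner
   errors. *)
have key (P : seq G) : uniq P -> {subset P <= Q} -> exists T : {fset G},
  [/\ forall t, t \in T -> exists2 c, c \in P & exists2 b, b \in A & t = (c * b)%g,
      #|` T| = (size P * #|` A|)%N &
      (#|` (T `\` Phi)%fset| <= \sum_(c <- P) #|` symdiff (ltranslate c Phi) Phi|)%N].
  elim: P => [_ _|c P ih /= /andP[cP uP] cPQ].
    by exists fset0; split=> //; rewrite ?fset0D ?cardfs0.
  have [|T [TP cT TPhi]] := ih uP; first by move=> x xP; apply: cPQ; rewrite inE xP orbT.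
  have cQ : c \in Q by apply: cPQ; rewrite mem_head.
  have dis : [disjoint ltranslate c A & T]%fset.
    apply/fdisjointP => t /imfsetP[b /= bA ->]; apply/negP => /TP[c' c'P [b' b'A e]].
    have cc' : c = c'.
      apply: sep e => //.
      - by move: bA; rewrite !inE => /andP[_ /asboolP].
      - by move: b'A; rewrite !inE => /andP[_ /asboolP].
      - by apply: cPQ; rewrite inE c'P orbT.
    by move: cP; rewrite cc' c'P.
  exists (ltranslate c A `|` T)%fset; split.
  - move=> t; rewrite inE => /orP[/imfsetP[b /= bA ->]|/TP[c' c'P bP]].
      by exists c; [rewrite mem_head | exists b].
    by exists c' => //; rewrite inE c'P orbT.
  - rewrite cardfsU (eqP dis) cardfs0 subn0 cT /= mulSn; congr (_ + _)%N.
    by rewrite card_imfset//; exact: mulgI.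
  - rewrite big_cons fsetDUl cardfsU (leq_trans (leq_subr _ _))//.
    rewrite leq_add//; apply: fsubset_leq_card; apply/fsubsetP => t.
    rewrite in_fsetD => /andP[tPhi /imfsetP[b /= bA tb]].
    rewrite in_fsetU in_fsetD tPhi /=; apply/orP; left; apply/imfsetP.
    by exists b => //; move: bA; rewrite !inE => /andP[].
have [T [_ cT TPhi]] := key Q uQ (fun _ h => h).
have TF : (size Q * #|` A| <= #|` Phi| +
    \sum_(c <- Q) #|` symdiff (ltranslate c Phi) Phi|)%N.
  rewrite -cT -(cardfsID Phi T) leq_add//.
  by apply: fsubset_leq_card; exact: fsubsetIr.
rewrite cA.
have sum1 : (\sum_(c <- Q) #|` symdiff (ltranslate c Phi) Phi|)%:R <= #|` Phi|%:R :> R.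
  rewrite natr_sum.
  apply: (@le_trans _ _ (\sum_(c <- Q) #|` Phi|%:R / (size Q)%:R)).
    rewrite !big_seq; apply: ler_sum => c cQ.
    by have := ev c cQ; rewrite ler_pdivrMr// mulrC.
  rewrite big_const_seq count_predT iter_addr_0 -[leLHS]mulr_natr mulfVK//.
  by rewrite pnatr_eq0 -lt0n.
have h : (size Q)%:R * #|` A|%:R <= 2 * #|` Phi|%:R :> R.
  rewrite -natrM; move: TF; rewrite -(ler_nat R) natrD => /le_trans; apply.
  by rewrite mulr_natl mulr2n lerD2l.
rewrite mulrAC ler_pdivlMr ?ltr0n//.
by rewrite mulrC.
Qed.

End Density.

(** * The Toeplitz array and its fibers over the compactification *)

Section Fibers.
Variables (R : realType) (G : groupType) (K : topGroupType) (iota : G -> K).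
Variable nu : probability (borel_type K) R.
Variables (e : nat -> G) (p : K) (Hs : nat -> set K).
Hypothesis e_surj : forall g, exists n, e n = g.
Hypotheses (cK : compact [set: K]) (hK : hausdorff_space K).
Hypotheses (iotaM : {morph iota : x y / (x * y)%g})
  (iota_dense : dense (range iota)).
Hypothesis HsP : forall n, open_normal (Hs n).
Hypothesis Hs_anti : forall m n, (m <= n)%N -> Hs n `<=` Hs m.
Hypothesis Hs_basis :
  forall O : set K, nbhs (1%g : K) O -> exists n, Hs n `<=` O.
Variables W M : nat -> set K.
Hypothesis T : tower iota nu e p Hs W M.

Notation color := (color M).
Notation colored := (colored W).
Notation color_upto := (color_upto W M).

Definition toeplitz_array : config G (option bool) := fun g => color (iota g).
Notation eta := toeplitz_array.

(* [lies_over x y] says that [(x, y)] is in the closure of the orbit of [(eta, 1)]. *)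
Definition lies_over (x : config G (option bool)) (y : K) : Prop :=
  forall (s : seq G) (U : set K), nbhs y U ->
    exists g, U (iota g) /\ forall h, h \in s -> x h = eta (g^-1 * h)%g.

(** By the periods of [color_upto n], each [iota g] close to [y] gives the same level-[n] coloring
    as [y], and such a [g] can be chosen to match [x] on [s]. Facts about [eta] thus pass to [x]. *)
Lemma over_approx x y (s : seq G) n : lies_over x y ->
  exists g, (forall h, h \in s -> x h = eta (g^-1 * h)%g) /\
    forall w, color_upto n ((iota g)^-1 * w)%g = color_upto n (y^-1 * w)%g.
Proof.
move=> xy.
have [H [oH sH _] HP] := locally_constant_period cK (color_upto_locally_constant iotaM T n).
have nH : nbhs y (lcoset y H).
  by apply: open_nbhs_nbhs; split; [exact: lcoset_open | exact: lcoset_refl].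
have [g [Hg xg]] := xy s _ nH; exists g; split=> // w.
case: sH => _ _ HV.
have := HP _ (HV _ Hg) 1%g (y^-1 * w)%g; rewrite !mul1g => <-.
by rewrite invgM invgK mulgA mulgK.
Qed.

(** Colored positions are determined by [y] alone; the remaining ones are the holes of [x]. *)
Lemma over_value x y n h : lies_over x y -> W n (y^-1 * iota h)%g ->
  x h = color (y^-1 * iota h)%g.
Proof.
move=> /(over_approx [:: h] n)[g [xg cg]] Wh.
rewrite xg ?mem_head// /eta iotaM (iotaV iotaM).
by have /color_upto_eq[[_ W'] ->//] := cg (iota h); exact: W'.
Qed.

Lemma over_separated x y n h h' : lies_over x y -> x h <> None -> x h' <> None ->
  ~ W n (y^-1 * iota h)%g -> ~ W n (y^-1 * iota h')%g ->
  (h^-1 * h')%g \in sym_enum e n -> h = h'.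
Proof.
move=> /(over_approx [:: h; h'] n)[g [xg cg]] xh xh' nWh nWh' hh'.
have eqh' : (iota (g^-1 * h) * iota (h^-1 * h') = iota (g^-1 * h'))%g.
  by rewrite -iotaM -mulgA mulVKg.
have Wg k : W n (iota (g^-1 * k)%g) <-> W n (y^-1 * iota k)%g.
  by rewrite iotaM (iotaV iotaM); have /color_upto_eq[] := cg (iota k).
have /mulg1_eq : (h^-1 * h' = 1)%g.
  apply: (color_separated iotaM T (n := n) (w := iota (g^-1 * h)%g)) => //.
  - by rewrite -[color _]/(eta _) -xg// mem_head.
  - by rewrite eqh' -[color _]/(eta _) -xg// !inE eqxx orbT.
  - by move/Wg.
  - by rewrite eqh' => /Wg.
by rewrite invgK.
Qed.

Lemma colored_open : open colored.
Proof.
rewrite openE => w [n Ww]; apply: (@filterS _ _ _ (W n)).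
  by move=> z Wz; exists n.
by apply: open_nbhs_nbhs; split=> //; exact: (tower_open T).
Qed.

(** For [b] different from [1], the color at [b * u] equals that at [u] on a dense set of colored
    [u]. Near [p] the color at [u] takes both values [Some true] and [Some false], whereas being
    [Some true] is locally constant near [b * p]. *)
Lemma over_inj x y y' : lies_over x y -> lies_over x y' -> y = y'.
Proof.
move=> xy xy'; apply: contrapT => yy'.
pose b := (y'^-1 * y)%g.
have bp : (b * p)%g <> p.
  move=> bp; apply: yy'; have /mulg1_eq : b = 1%g.
    by apply: (mulIg p); rewrite bp mul1g.
  by rewrite invgK.
have nq := color_true_locally_constant iotaM hK HsP Hs_anti Hs_basis T bp.
have np := near_mulgl nq.
(* A coordinate [h] is sought whose position is in [Z] for [y] and colored for [y']; reading [x h]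
   both ways gives the equality of colors. *)
have claim n (Z : set K) c : open Z -> Z !=set0 -> Z `<=` W n ->
    (forall w, Z w -> color w = c) -> exists u, Z u /\ color (b * u)%g = c.
  move=> oZ [z Zz] ZW Zc.
  have [v [Zv [m Wv]]] : [set v | Z (b^-1 * v)%g] `&` colored !=set0.
    apply: (colored_dense e_surj iota_dense T); last exact: open_mulgl.
    by exists (b * z)%g; rewrite /= mulKg.
  have [h [Zh Wh]] : exists h, Z (b^-1 * (y'^-1 * iota h))%g /\ W m (y'^-1 * iota h)%g.
    have oZW : open ([set v | Z (b^-1 * v)%g] `&` W m).
      by apply: openI; [exact: open_mulgl | exact: (tower_open T)].
    apply: (denseP iota_dense (open_mulgl y'^-1%g oZW)).
    by exists (y' * v)%g; rewrite /= mulKg.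
  exists (y^-1 * iota h)%g.
  have eqh : (b^-1 * (y'^-1 * iota h) = y^-1 * iota h)%g.
    by rewrite /b invgM invgK mulgA mulgK.
  have eqh' : (b * (y^-1 * iota h) = y'^-1 * iota h)%g.
    by rewrite /b mulgA mulgK.
  rewrite eqh in Zh; split=> //.
  rewrite eqh' -(over_value xy' Wh) (over_value xy (ZW _ Zh)).
  exact: Zc.
have [n [[Z [oZ Z0 ZO ZW Zc]] _]] :=
  uncolored_accumulation e_surj iotaM iota_dense HsP Hs_basis T (uncolored_p T) np.
have [u [Zu cu]] := claim _ _ _ oZ Z0 ZW Zc.
have [n' [Z' [oZ' Z'0 Z'O Z'W Z'c]]] := p_accumulation iotaM HsP Hs_anti Hs_basis T np.
have [u' [Zu' cu']] := claim _ _ _ oZ' Z'0 Z'W Z'c.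
have /= eu := ZO _ Zu; have /= eu' := Z'O _ Zu'.
by move: cu'; rewrite eu' -eu cu.
Qed.

(** [y] is a cluster point in [K] of the elements [iota g] whose shifts of [eta] approximate [x]. *)
Lemma over_ex_right x : closure (gorbit eta) x -> exists y, lies_over x y.
Proof.
move=> clx.
pose F := filter_from [set: seq G] (fun s =>
  [set y | exists2 g, y = iota g & forall h, h \in s -> x h = eta (g^-1 * h)%g]).
have FF : Filter F.
  apply: filter_from_filter; first by exists [::].
  move=> s t _ _; exists (s ++ t) => // _ [g -> st].
  by split; exists g => // h hs; apply: st; rewrite mem_cat hs ?orbT.
have PF : ProperFilter F.
  apply: filter_from_proper => s _.
  have [_ [[g _ <-] gx]] := clx _ (config_cylinder_nbhs x s).
  by exists (iota g); exists g => // h /gx.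
have [y [_ yF]] := cK PF filterT.
exists y => s U yU.
have Fs : F [set y | exists2 g, y = iota g & forall h, h \in s -> x h = eta (g^-1 * h)%g].
  by exists s.
have [_ [[g -> xg] Ug]] := yF _ _ Fs yU.
by exists g.
Qed.

Lemma over_closure x y : lies_over x y -> closure (gorbit eta) x.
Proof.
move=> xy B /config_nbhsP[s sB].
have [g [_ xg]] := xy s setT filterT.
exists (gshift g eta); split; first by exists g.
by apply: sB => h /xg.
Qed.

(** Dually, [x] is a cluster point in the full shift of the shifts of [eta] by [g] with [iota g]
    near [y]. *)
Lemma over_ex_left y : exists x, lies_over x y.
Proof.
pose F := filter_from (nbhs y) (fun U =>
  [set x : config G (option bool) | exists2 g, U (iota g) & x = gshift g eta]).
have FF : Filter F.
  apply: filter_from_filter; first by exists setT; exact: filterT.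
  move=> U V nU nV; exists (U `&` V); first exact: filterI.
  by move=> _ [g [Ug Vg] ->]; split; exists g.
have PF : ProperFilter F.
  apply: filter_from_proper => U; rewrite nbhsE => -[V [oV Vy] VU].
  have [g Vg] := denseP iota_dense oV (ex_intro _ y Vy).
  by exists (gshift g eta), g => //; exact: VU.
have [x [_ xF]] := @config_compact G (option bool) F PF filterT.
exists x => s U yU.
have FU : F [set x : config G (option bool) | exists2 g, U (iota g) & x = gshift g eta].
  by exists U.
have [_ [[g Ug ->] gx]] := xF _ _ FU (config_cylinder_nbhs x s).
by exists g; split=> // h /gx.
Qed.

Lemma over_shift g x y : lies_over x y -> lies_over (gshift g x) (iota g * y)%g.
Proof.
move=> xy s U /near_mulgl nU.
have [h [Uh xh]] := xy [seq (g^-1 * k)%g | k <- s] _ nU.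
exists (g * h)%g; split; first by rewrite iotaM.
move=> k ks; rewrite /gshift xh ?map_f//.
by rewrite invgM mulgA.
Qed.

Lemma over_closed x y : ~ lies_over x y -> exists (s : seq G) (U : set K),
  nbhs y U /\ forall x' y', (forall g, g \in s -> x' g = x g) -> U y' -> ~ lies_over x' y'.
Proof.
move=> /existsNP[s /existsNP[U /not_implyP[nU noU]]].
have [V [oV Vy] VU] : exists2 V, open_nbhs y V & V `<=` U by rewrite nbhsE in nU.
exists s, V; split; first exact: open_nbhs_nbhs.
move=> x' y' x'x Vy' x'y'; apply: noU.
have [g [Vg xg]] := x'y' s V (open_nbhs_nbhs (conj oV Vy')).
by exists g; split=> [|h hs]; [exact: VU | rewrite -x'x// xg].
Qed.

Lemma over_eta : lies_over eta 1%g.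
Proof.
move=> s U nU; exists 1%g; split; first by rewrite (iota1 iotaM); exact: nbhs_singleton.
by move=> h _; rewrite invg1 mul1g.
Qed.

Lemma preimage_finite_index (H : set K) : open_normal H ->
  finite_index_subgroup (iota @^-1` H).
Proof.
move=> [oH [H1 HM HV] nH]; split.
  split=> [|x y Hx Hy|x Hx]; rewrite /preimage/=.
  - by rewrite (iota1 iotaM).
  - by rewrite iotaM; exact: HM.
  - by rewrite (iotaV iotaM); exact: HV.
have := cK; rewrite compact_cover => /(_ G setT (fun g => lcoset (iota g) H)).
case=> [g _||D _ DK].
- exact: lcoset_open.
- move=> w _.
  have [g wg] : exists g, lcoset w H (iota g).
    by apply: (denseP iota_dense (lcoset_open w oH)); exists w; apply: lcoset_refl.
  exists g => //; rewrite /lcoset/=.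
  have -> : ((iota g)^-1 * w = (w^-1 * iota g)^-1)%g by rewrite invgM invgK.
  exact: HV.
apply: (@sub_finite_set _ _ [set [set (g * h)%g | h in iota @^-1` H] | g in [set` D]]);
  last exact/finite_image/finite_fset.
move=> _ [g _ <-]; have [g' g'D Hg] := DK (iota g) I; exists g' => //.
apply/seteqP; split=> _ [h Hh <-].
  exists (g^-1 * (g' * h))%g; last by rewrite mulVKg.
  rewrite /preimage/= !iotaM (iotaV iotaM) mulgA; apply: HM => //.
  have -> : ((iota g)^-1 * iota g' = ((iota g')^-1 * iota g)^-1)%g by rewrite invgM invgK.
  exact: HV.
exists (g'^-1 * (g * h))%g; last by rewrite mulVKg.
by rewrite /preimage/= !iotaM (iotaV iotaM) mulgA; apply: HM.
Qed.

(** The periods of [color_upto n] pull back to a finite index subgroup of [G]. Their two-sidedness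
    enters because [c] stands between [y^-1] and [iota h]. *)
Lemma over_toeplitz x y : lies_over x y -> (forall h, colored (y^-1 * iota h)%g) ->
  toeplitz x.
Proof.
move=> xy ch h; have [n Wn] := ch h.
have [H onH HP] := locally_constant_period cK (color_upto_locally_constant iotaM T n).
exists (iota @^-1` H); first exact: preimage_finite_index.
move=> c Hc.
have := HP _ Hc y^-1%g (iota h); rewrite -mulgA -iotaM => /color_upto_eq[[_ W'] cc].
have Wc := W' Wn.
by rewrite (over_value xy Wc) (over_value xy Wn) cc.
Qed.

(** The closures of the finitely many cosets cover [K], so a point near [1] lies in the closure of a
    coset [C] whose closure contains [1]. It is then a limit of quotients [k^-1 * l] with [k] and
    [l] in [C], which belong to [D]. *)
Lemma finite_index_closure (D : set G) : finite_index_subgroup D ->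
  nbhs (1%g : K) (closure (iota @` D)).
Proof.
move=> [[D1 DM DV] fD].
pose cl (C : set G) : set K := closure (iota @` C).
have clc P : closed (\bigcup_(C in left_cosets D `&` P) cl C).
  by apply: closed_bigcup => [|C _]; [exact: finite_setIl | exact: closed_closure].
pose A := \bigcup_(C in left_cosets D `&` [set C | ~ cl C 1%g]) cl C.
have nA : nbhs (1%g : K) (~` A).
  apply: open_nbhs_nbhs; split; first exact/closed_openC/clc.
  by move=> [C [_ nC] /nC].
apply: filterS nA => y nAy.
have [C [[g _ gC] _] clCy] : (\bigcup_(C in left_cosets D `&` setT) cl C) y.
  apply: contrapT => ny.
  have [g] := denseP iota_dense (closed_openC (clc setT)) (ex_intro _ y ny).
  apply; exists [set (g * h)%g | h in D].
    by split=> //; exists g.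
  by apply: subset_closure; exists g => //; exists 1%g => //; rewrite mulg1.
have clC1 : cl C 1%g.
  by apply: contrapT => nC1; apply: nAy; exists C => //; split=> //; exists g.
move=> B nB.
have [[U V] [/= nU nV] UVB] : nbhs ((1%g : K), y) [set q | B (q.1^-1 * q.2)%g].
  have : (fun q : K * K => (q.1^-1 * q.2)%g) @ ((1%g : K), y) --> (1^-1 * y)%g.
    apply: cvg_mulg; last exact: cvg_snd.
    by apply: (cvg_comp fst (fun x : K => x^-1%g) (G := nbhs (1%g : K)));
      [exact: cvg_fst | exact: invg_continuous].
  by move/(_ B); apply; rewrite invg1 mul1g.
have [_ [[k Ck <-] Uk]] := clC1 _ nU.
have [_ [[l Cl <-] Vl]] := clCy _ nV.
move: Ck Cl; rewrite -gC => -[d Dd dk] [d' Dd' dl].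
exists (iota (d^-1 * d')%g); split.
  by exists (d^-1 * d')%g => //; apply: DM => //; exact: DV.
have -> : (d^-1 * d' = k^-1 * l)%g.
  by rewrite -dk -dl invgM mulgA mulgVK.
rewrite iotaM (iotaV iotaM).
exact: (UVB (iota k, iota l)).
Qed.

(** A period group [D] at a hole [h] would make [x] constant on positions dense near that of [h],
    while [uncolored_accumulation] provides open sets there with colors [Some false] and [None]. *)
Lemma toeplitz_over x y h : lies_over x y -> toeplitz x -> colored (y^-1 * iota h)%g.
Proof.
move=> xy tx; apply: contrapT => nch.
have [D fD Dh] := tx h.
have nD := finite_index_closure fD.
have np : nbhs (y^-1 * iota h)%g
    [set u | closure (iota @` D) (y * u * (iota h)^-1)%g].
  have : (fun u => (y * u * (iota h)^-1)%g) @ (y^-1 * iota h)%g -->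
      (y * (y^-1 * iota h) * (iota h)^-1)%g.
    apply: cvg_mulg; last exact: cvg_cst.
    exact: mulgl_continuous.
  by move/(_ (closure (iota @` D))); apply; rewrite mulVKg mulgV.
have [n [[Z ZP] [Z' Z'P]]] :=
  uncolored_accumulation e_surj iotaM iota_dense HsP Hs_basis T nch np.
have claim (B : set K) c : [/\ open B, B !=set0,
    B `<=` [set u | closure (iota @` D) (y * u * (iota h)^-1)%g], B `<=` W n &
    forall w, B w -> color w = c] -> x h = c.
  move=> [oB [z Bz] BD BW Bc].
  have oB' : open [set v | B (y^-1 * v * iota h)%g].
    apply: (open_comp (f := fun v => (y^-1 * v * iota h)%g)) => // v _.
    by apply: cvg_mulg; [exact: mulgl_continuous | exact: cvg_cst].
  have [_ [[d Dd <-] Bd]] : iota @` D `&` [set v | B (y^-1 * v * iota h)%g] !=set0.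
    apply: (BD _ Bz); apply: open_nbhs_nbhs; split=> //=.
    by rewrite !mulgA mulVg mul1g mulgVK.
  rewrite /= -mulgA -iotaM in Bd.
  by rewrite -(Dh d Dd) (over_value xy (BW _ Bd)) Bc.
by have := claim _ _ ZP; rewrite (claim _ _ Z'P).
Qed.

End Fibers.

(** * The factor map *)

Lemma limn_esup_le_near (R : realType) (u : nat -> \bar R) (l : \bar R) :
  (\forall n \near \oo, (u n <= l)%E) -> (limn_esup u <= l)%E.
Proof.
move=> ul; rewrite /limn_esup limf_esupE.
apply: (@le_trans _ _ (ereal_sup (u @` [set n | (u n <= l)%E]))).
  by apply: ereal_inf_lbound; exists [set n | (u n <= l)%E].
by apply: ge_ereal_sup => _ [n /= un <-].
Qed.

Lemma infinite_notin (G : choiceType) (s : seq G) :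
  infinite_set [set: G] -> exists g, g \notin s.
Proof.
move=> infG; apply: contrapT => nog; apply: infG.
apply: (@sub_finite_set _ _ [set` s]); last exact: finite_seq.
by move=> g _ /=; apply: contrapT => /negP gs; apply: nog; exists g.
Qed.

Section SubshiftSystem.
Variables (R : realType) (G : groupType) (S : finType) (eta : config G S).
Variable e : nat -> G.
Hypothesis e_surj : forall g, exists n, e n = g.
Notation X := (subshift eta).

Lemma subshift_actE g (x : X) h :
  set_val (subshift_act eta g x) h = set_val x (g^-1 * h)%g.
Proof. by []. Qed.

Lemma subshift_ext (x z : X) : (forall g, set_val x g = set_val z g) -> x = z.
Proof. by move=> xz; apply: val_inj; apply/funext => g; exact: xz. Qed.

Lemma enum_bound (s : seq G) : exists n, forall g, g \in s -> exists2 i, (i <= n)%N & e i = g.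
Proof.
elim: s => [|g s [n sn]]; first by exists 0%N.
have [m gm] := e_surj g; exists (maxn m n) => h; rewrite inE => /predU1P[->|/sn[i iN hi]].
  by exists m => //; exact: leq_maxl.
by exists i => //; rewrite (leq_trans iN)// leq_maxr.
Qed.

Lemma subshift_metric : exists d : X -> X -> R, compatible_metric d /\
  forall x z n, d x z < n.+1%:R^-1 <->
    forall i, (i <= n)%N -> set_val x (e i) = set_val z (e i).
Proof.
apply: (@coordinate_metrizable R X S (fun x n => set_val x (e n))).
  move=> x z xz; apply: subshift_ext => g.
  by have [n <-] := e_surj g; exact: xz.
move=> x A; rewrite subshift_nbhsP; split=> [[s sA]|[n nA]].
  have [n sn] := enum_bound s; exists n => z zx; apply: sA => g /sn[i iN <-].
  exact: zx.
by exists (mkseq e n.+1) => z zx; apply: nA => i iN; apply: zx; apply/mem_mkseq; exists i.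
Qed.

(** The Lebesgue number of the compact subshift, expressed as a finite window of coordinates. *)
Lemma subshift_uniform (A : X -> X -> Prop) :
  (forall x : X, exists2 N : set X, nbhs x N & forall y z, N y -> N z -> A y z) ->
  exists s : seq G, forall y z,
    (forall g, g \in s -> set_val y g = set_val z g) -> A y z.
Proof.
move=> hA; have [d [dP dlt]] := subshift_metric.
have [r r0 rA] := lebesgue_number dP (@subshift_compact G S eta) hA.
exists (mkseq e (Num.truncn r^-1).+1) => y z yz; apply: rA.
have : d y z < (Num.truncn r^-1).+1%:R^-1.
  by apply/dlt => i iN; apply: yz; apply/mem_mkseq; exists i.
move=> /lt_le_trans; apply.
by rewrite -[leRHS]invrK lef_pV2 ?posrE ?invr_gt0// ltW// truncnS_gt.
Qed.

Lemma subshift_system : dynamical_system R (subshift_act eta).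
Proof.
split.
- exact: subshift_compact.
- by have [d [dP _]] := subshift_metric; exists d.
- move=> x; apply: subshift_ext => h.
  by rewrite subshift_actE invg1 mul1g.
- move=> g h x; apply: subshift_ext => k.
  by rewrite !subshift_actE invgM mulgA.
- move=> g x A /subshift_nbhsP[s sA].
  apply/subshift_nbhsP; exists [seq (g^-1 * h)%g | h <- s] => z zx.
  by apply: sA => h hs; rewrite !subshift_actE; apply: zx; rewrite map_f.
Qed.

End SubshiftSystem.

(** The metric need not be invariant, but compactness makes [d w (w * h)] small uniformly in [w] for
    [h] near [1], and a left translation does not change [x^-1 * y]. *)
Lemma translation_system (R : realType) (G : groupType) (K : topGroupType)
    (iota : G -> K) : compact [set: K] -> metrizable R K ->
  {morph iota : x y / (x * y)%g} -> equicontinuous_system R (translation iota).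
Proof.
move=> cK mK iotaM; split.
  split=> // [x|g h x|g x]; rewrite /translation.
  - by rewrite (iota1 iotaM) mul1g.
  - by rewrite iotaM mulgA.
  - exact: mulgl_continuous.
move=> d dP eps eps0.
have e2 : 0 < eps / 2 by rewrite divr_gt0.
have nH : \forall h \near (1%g : K), forall w, d w (w * h)%g < eps / 2.
  have /compact_near_coveringP cov := cK.
  have {}cov := cov _ (nbhs (1%g : K)) (fun h w => d w (w * h)%g < eps / 2) (nbhs_filter _).
  apply: filterS (cov _) => [h hP w|w _ /=]; first exact: (hP w I).
  have e4 : 0 < eps / 2 / 2 by rewrite divr_gt0.
  have nB := compatible_metric_ball dP w e4.
  have n1 : \forall q \near (w, 1%g : K), d w (q.1 * q.2)%g < eps / 2 / 2.
    have : (fun q : K * K => (q.1 * q.2)%g) @ (w, 1%g : K) --> (w * 1)%g.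
      by apply: cvg_mulg; [exact: cvg_fst | exact: cvg_snd].
    by move/(_ [set y | d w y < eps / 2 / 2]); apply; rewrite mulg1.
  have n2 : \forall q \near (w, 1%g : K), d w q.1 < eps / 2 / 2.
    have : (fun q : K * K => q.1) @ (w, 1%g : K) --> w by exact: cvg_fst.
    by move/(_ [set y | d w y < eps / 2 / 2]); apply.
  apply: filterS2 n1 n2 => q wq1 wq; case: (dP) => _ dC dT _.
  rewrite (le_lt_trans (dT _ w _))// [ltRHS]splitr ltrD//.
  by rewrite dC.
apply: (lebesgue_number dP cK (A := fun x y => forall g,
  d (translation iota g x) (translation iota g y) < eps)) => x.
exists [set y | forall w, d w (w * (x^-1 * y))%g < eps / 2].
  have := @near_mulgl _ x^-1%g x [set h | forall w, d w (w * h)%g < eps / 2].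
  by rewrite mulVg; apply.
move=> y z yP zP g; case: (dP) => _ dC dT _.
have := yP (iota g * x)%g; have := zP (iota g * x)%g.
rewrite -!mulgA !mulVKg => hz hy.
rewrite (le_lt_trans (dT _ (iota g * x)%g _))// [ltRHS]splitr ltrD//.
by rewrite dC.
Qed.

Section FactorMap.
Variables (R : realType) (G : groupType) (K : topGroupType) (iota : G -> K).
Variable nu : probability (borel_type K) R.
Variables (e : nat -> G) (p : K) (Hs : nat -> set K).
Hypothesis G_infinite : infinite_set [set: G].
Hypothesis e_surj : forall g, exists n, e n = g.
Hypotheses (cK : compact [set: K]) (mK : metrizable R K).
Hypotheses (iota_inj : injective iota) (iotaM : {morph iota : x y / (x * y)%g})
  (iota_dense : dense (range iota)).
Hypothesis HsP : forall n, open_normal (Hs n).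
Hypothesis Hs_anti : forall m n, (m <= n)%N -> Hs n `<=` Hs m.
Hypothesis Hs_basis :
  forall O : set K, nbhs (1%g : K) O -> exists n, Hs n `<=` O.
Variables W M : nat -> set K.
Hypothesis T : tower iota nu e p Hs W M.

Notation color := (color M).
Notation colored := (colored W).
Notation color_upto := (color_upto W M).
Notation eta := (toeplitz_array iota M).
Notation X := (subshift eta).
Notation lies_over := (lies_over iota M).

Let hK : hausdorff_space K.
Proof. by have [d dP] := mK; exact: compatible_metric_hausdorff dP. Qed.

Definition eta_factor (x : X) : K := projT1 (cid (over_ex_right cK (set_valP x))).

Lemma over_factor x : lies_over (set_val x) (eta_factor x).
Proof. by rewrite /eta_factor; case: (cid _). Qed.

Arguments over_factor : clear implicits.

Lemma overP (x : X) y : lies_over (set_val x) y <-> eta_factor x = y.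
Proof.
split=> [xy|<-]; last exact: over_factor.
exact: (over_inj e_surj cK hK iotaM iota_dense HsP Hs_anti Hs_basis T
  (over_factor x) xy).
Qed.

Lemma factor_surj y : exists x, eta_factor x = y.
Proof.
have [x xy] := over_ex_left iota_dense M y.
by exists (SigSub (mem_set (over_closure xy))); apply/overP.
Qed.

(** The relation [lies_over] is closed and [K] is compact, so the closed graph argument applies. *)
Lemma factor_continuous : continuous eta_factor.
Proof.
move=> x N; rewrite nbhsE => -[V [oV Vx] VN].
have /compact_near_coveringP cov : compact (~` V).
  by apply: (subclosed_compact _ cK) => //; exact: open_closedC.
have {}cov := cov _ (nbhs x) (fun x' y' => ~ lies_over (set_val x') y') (nbhs_filter _).
apply: filterS (cov _) => [x' x'V|y nVy /=].
  by apply: VN; apply: contrapT => /x'V; apply; exact: over_factor.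
have /over_closed[s [U [nU sU]]] : ~ lies_over (set_val x) y.
  by move=> /overP xy; apply: nVy; rewrite -xy.
exists (U, [set x' : X | forall g, g \in s -> set_val x' g = set_val x g]).
  by split=> //=; apply/subshift_nbhsP; exists s.
by move=> [y' x'] /= [Uy' x'x]; exact: sU.
Qed.

Lemma factor_map_factor :
  factor_map (subshift_act eta) (translation iota) eta_factor.
Proof.
split; first exact: factor_continuous.
  by apply/seteqP; split=> // y _; have [x <-] := factor_surj y; exists x.
by move=> g x; apply/overP/over_shift => //; exact: over_factor.
Qed.

(* A fiber point has at most one colored hole, because two of them would violate
   the separation of the marks at every level. *)
Lemma colored_holes (x : X) : exists t : seq G, forall h,
  set_val x h <> None -> ~ colored ((eta_factor x)^-1 * iota h)%g -> h \in t.
Proof.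
have [[h0 [xh0 nc0]]|noh] := pselect (exists h, set_val x h <> None /\
    ~ colored ((eta_factor x)^-1 * iota h)%g); last first.
  by exists [::] => h xh nc; case: noh; exists h.
exists [:: h0] => h xh nc; rewrite inE; apply/eqP.
have [n hn] := sym_enum_ex e_surj (h^-1 * h0)%g.
apply: (over_separated cK iotaM T (over_factor x) xh xh0 _ _ hn).
  by move=> Wh; apply: nc; exists n.
by move=> Wh; apply: nc0; exists n.
Qed.

(** Two points of a fiber differ only at their finitely many colored holes, and the infinite group
    contains a [g] moving the window [s] off them. *)
Lemma fiber_proximal (x z : X) (s : seq G) : eta_factor x = eta_factor z ->
  exists g, forall h, h \in s ->
    set_val (subshift_act eta g x) h = set_val (subshift_act eta g z) h.
Proof.
move=> xz; have [t xt] := colored_holes x; have [u zu] := colored_holes z.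
have [g gP] := infinite_notin [seq (h * k^-1)%g | h <- s, k <- t ++ u] G_infinite.
exists g => h hs; rewrite !subshift_actE.
have nk : (g^-1 * h)%g \notin t ++ u.
  apply: contra gP => k; apply/allpairsP; exists (h, (g^-1 * h)%g); split=> //=.
  by rewrite invgM invgK mulVKg.
move: nk; rewrite mem_cat negb_or => /andP[nt nu'].
set k := (g^-1 * h)%g in nt nu' *.
have [[n Wk]|nc] := pselect (colored ((eta_factor x)^-1 * iota k)%g).
  rewrite (over_value cK iotaM T (over_factor x) Wk).
  by rewrite xz in Wk *; rewrite (over_value cK iotaM T (over_factor z) Wk).
have -> : set_val x k = None.
  by apply: contrapT => xk; move/negP: nt; apply; exact: xt.
apply/esym; apply: contrapT => zk; move/negP: nu'; apply; apply: zu => //.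
by rewrite -xz.
Qed.

Lemma factor_maximal :
  maximal_equicontinuous_factor R (subshift_act eta) (translation iota) eta_factor.
Proof.
split; [exact: translation_system | exact: factor_map_factor |].
move=> Z actZ psi [[cZ [d dP] actZ1 actZM _] eqZ] [psic psiT psiE].
have fib x z : eta_factor x = eta_factor z -> psi x = psi z.
  (* Some [g] brings the images closer than the equicontinuity modulus [r] of their own distance;
     applying [g^-1] makes this distance smaller than itself. *)
  move=> xz; case: (dP) => d0 dC dT _; apply/d0/eqP; apply: contraT => dxz.
  have dxz0 : 0 < d (psi x) (psi z).
    by rewrite lt_neqAle eq_sym dxz (compatible_metric_ge0 dP).
  have [r r0 rP] := eqZ d dP _ dxz0.
  have near_psi (u : X) : exists2 N : set X, nbhs u N &
      forall v w, N v -> N w -> d (psi v) (psi w) < r.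
    exists (psi @^-1` [set w | d (psi u) w < r / 2]).
      by apply: psic; apply: compatible_metric_ball => //; rewrite divr_gt0.
    move=> v w /= uv uw; rewrite (le_lt_trans (dT _ (psi u) _))// (splitr r) ltrD//.
    by rewrite dC.
  have [s sP] := subshift_uniform R e_surj near_psi.
  have [g gP] := fiber_proximal s xz.
  have := rP _ _ (sP _ _ gP) g^-1%g.
  by rewrite !psiE -!actZM mulVg !actZ1 ltxx.
have [sec secP] := choice factor_surj.
pose chi y := psi (sec y).
have chiE x : chi (eta_factor x) = psi x by apply: fib; rewrite secP.
exists chi; last by apply/funext => x; rewrite /= chiE.
split.
(* The surjection [eta_factor] from a compact space to a Hausdorff one is closed, so [chi] inherits
   continuity from [psi]. *)
- apply/continuous_closedP => C cC.
  have -> : chi @^-1` C = eta_factor @` (psi @^-1` C).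
    apply/seteqP; split=> [y Cy|_ [x Cx <-]]; last by rewrite /preimage/= chiE.
    by exists (sec y).
  apply: compact_closed => //; apply: continuous_compact.
    exact/continuous_subspaceT/factor_continuous.
  apply: (subclosed_compact _ (@subshift_compact G _ eta)) => //.
  by move/continuous_closedP : psic; apply.
- apply/seteqP; split=> // z _; have : range psi z by rewrite psiT.
  by move=> [x _ <-]; exists (eta_factor x).
- move=> g y; have [x <-] := factor_surj y.
  case: factor_map_factor => _ _ <-.
  by rewrite !chiE psiE.
Qed.

Lemma image_toeplitz_points :
  eta_factor @` toeplitz_points eta = [set y | forall h, colored (y^-1 * iota h)%g].
Proof.
apply/seteqP; split=> [_ [x tx <-] h|y cy].
  exact: (toeplitz_over e_surj cK iotaM iota_dense HsP Hs_basis T h (over_factor x) tx).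
have [x xy] := factor_surj y; exists x => //.
by apply: (over_toeplitz cK iotaM iota_dense T (over_factor x)); rewrite xy.
Qed.

Lemma eta_toeplitz : toeplitz eta.
Proof.
apply: (over_toeplitz cK iotaM iota_dense T (over_eta iotaM M)) => h.
by rewrite invg1 mul1g; have [n <-] := e_surj h; exists n.+1; exact: (tower_iota T).
Qed.

(** The image is a countable intersection of open sets, contained in the inverse of [colored] by the
    condition at the identity; continuity from below bounds the measure of that inverse by one
    half. *)
Lemma factor_irregular : irregular nu eta_factor.
Proof.
have oC : open colored := colored_open T.
have oCh h : open [set y | colored (y^-1 * iota h)%g].
  apply: (open_comp (f := fun y => (y^-1 * iota h)%g)) => // y _.
  by apply: cvg_mulg; [exact: invg_continuous | exact: cvg_cst].
have oW n : open (inv_set (W n)) by apply: inv_set_open; exact: tower_open T n.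
have hle : (nu (inv_set colored) <= 2^-1%:E)%E.
  have -> : inv_set colored = \bigcup_n inv_set (W n).
    by apply/seteqP; split=> w [n]; [exists n | exists n].
  have mW n : measurable (inv_set (W n) : set (borel_type K)).
    exact: (borel_open (oW n)).
  have monoW : {homo (fun n => inv_set (W n)) : m n / (m <= n)%N >-> (m <= n)%O}.
    by move=> m n mn; apply/subsetPset => w; exact: (tower_mono T mn).
  have cvg := @nondecreasing_cvg_mu _ _ _ nu (fun n => inv_set (W n)) mW
    (bigcup_measurable (fun n _ => mW n)) monoW.
  rewrite -(cvg_lim _ cvg)//.
  apply: lime_le; first by apply/cvg_ex; eexists; exact: cvg.
  by apply: nearW => n; have [_ _ /ltW] := tower_admissible T n.
have mT : measurable (eta_factor @` toeplitz_points eta : set (borel_type K)).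
  rewrite image_toeplitz_points.
  have -> : [set y | forall h, colored (y^-1 * iota h)%g] =
      \bigcap_n [set y | colored (y^-1 * iota (e n))%g].
    apply/seteqP; split=> [y cy n _|y cy h]; first exact: cy.
    by have [n <-] := e_surj h; exact: cy.
  by apply: bigcap_measurable => // n _; exact: (borel_open (oCh (e n))).
split=> //; rewrite /regular => nu1.
have : (nu (eta_factor @` toeplitz_points eta) <= nu (inv_set colored))%E.
  apply: le_measure; rewrite ?inE//.
    exact: (borel_open (inv_set_open oC)).
  rewrite image_toeplitz_points => y /(_ 1%g).
  by rewrite (iota1 iotaM) mulg1.
by rewrite nu1 => /le_trans/(_ hle); rewrite lee_fin leNgt invf_lt1// ltr1n.
Qed.

(** Close points have images in one coset of the period group of [color_upto n], hence the same
    level-[n] holes and colors. *)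
Lemma factor_coset_uniform (d : X -> X -> R) n : compatible_metric d ->
  exists2 r, 0 < r & forall x z, d x z < r -> forall w,
    color_upto n ((eta_factor x)^-1 * w)%g = color_upto n ((eta_factor z)^-1 * w)%g.
Proof.
move=> dP.
apply: (lebesgue_number dP (@subshift_compact G _ eta) (A := fun x z => forall w,
  color_upto n ((eta_factor x)^-1 * w)%g = color_upto n ((eta_factor z)^-1 * w)%g)) => x.
have [H [oH sH _] HP] :=
  locally_constant_period cK (color_upto_locally_constant iotaM T n).
have shift z : lcoset (eta_factor x) H (eta_factor z) -> forall w,
    color_upto n ((eta_factor z)^-1 * w)%g = color_upto n ((eta_factor x)^-1 * w)%g.
  case: sH => _ _ HV => /HV Hz w.
  have := HP _ Hz 1%g ((eta_factor x)^-1 * w)%g; rewrite !mul1g => <-.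
  by rewrite invgM invgK mulgA mulgK.
exists (eta_factor @^-1` lcoset (eta_factor x) H).
  apply: factor_continuous; apply: open_nbhs_nbhs.
  by split; [exact: lcoset_open | exact: lcoset_refl].
by move=> y z /shift hy /shift hz w; rewrite hy hz.
Qed.

(** The mean distance is split into [eps / 4] for windows free of colored level-[n] holes and
    [eps / 4] for the density of the others. *)
Lemma factor_mean_equicontinuous : mean_equicontinuous R (subshift_act eta).
Proof.
split; first exact: subshift_system.
move=> d dP eps eps0; case: (dP) => _ dC dT _.
have [C0 dC0] := compatible_metric_bounded dP (@subshift_compact G _ eta).
pose C := `|C0| + 1.
have C1 : 0 < C by rewrite ltr_wpDl.
have dleC u v : d u v <= C.
  by rewrite (le_trans (dC0 u v))// (le_trans (ler_norm C0))// lerDl.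
have e4 : 0 < eps / 4 by rewrite divr_gt0.
have [s sP] : exists s : seq G, forall y z : X,
    (forall g, g \in s -> set_val y g = set_val z g) -> d y z < eps / 4.
  apply: (subshift_uniform R e_surj) => u.
  exists [set v | d u v < eps / 4 / 2].
    by apply: compatible_metric_ball => //; rewrite divr_gt0.
  move=> v w /= uv uw; rewrite (le_lt_trans (dT _ u _))// [ltRHS]splitr ltrD//.
  by rewrite dC.
(* Each window position has density at most [2 / size Q] for each of [x] and [z] and costs at most
   [C]; this [k] brings the total below [eps / 4]. *)
pose k := (Num.truncn (C * (size s)%:R * 16 / eps)).+1.
have [Q0 _ kQ0] := infinite_set_fset k G_infinite.
pose Q : seq G := Q0.
have uQ : uniq Q by exact: fset_uniq.
have sQ0 : (0 < size Q)%N by apply: leq_trans kQ0.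
have sQ : C * (size s)%:R * (4 / (size Q)%:R) <= eps / 4.
  have q0 : 0 < (size Q)%:R :> R by rewrite ltr0n.
  have : C * (size s)%:R * 16 / eps <= (size Q)%:R.
    by apply: le_trans (ltW (truncnS_gt _)) _; rewrite ler_nat.
  by rewrite ler_pdivrMr// mulrA ler_pdivrMr// => h; lra.
(* If [c * b = c' * b'], the positions [b^-1 * h] and [b'^-1 * h] differ by such an element; a level
   [n] containing all of them forces [b = b'], so the translates of [B u h] by [Q] are disjoint. *)
pose tests := [seq (q.1^-1 * (q.2.1^-1 * q.2.2) * q.1)%g |
  q <- [seq (h, cc) | h <- s, cc <- [seq (c, c') | c <- Q, c' <- Q]]].
have [n testsn] := sym_enum_ex_seq e_surj tests.
have [r r0 rP] := factor_coset_uniform n dP.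
exists r => // x z xz; have cxz := rP _ _ xz.
(* A bound by [eps / 2] for each Folner sequence keeps the inequality strict after the supremum. *)
apply: (@le_lt_trans _ _ (eps / 2)%:E); last first.
  by rewrite lte_fin ltr_pdivrMr// mulr_natr mulr2n ltrDl.
apply: ge_ereal_sup => _ [F folF <-]; apply: limn_esup_le_near.
pose B (u : X) h : set G := [set g | set_val u (g^-1 * h)%g <> None /\
  ~ W n ((eta_factor u)^-1 * iota (g^-1 * h))%g].
have densB u h : h \in s -> \forall m \near \oo,
    (count (fun g => `[< B u h g >]) (F m))%:R <= 2 / (size Q)%:R * #|` F m|%:R :> R.
  move=> hs; apply: folner_density => // b b' c c' [ub nb] [ub' nb'] cQ c'Q cb.
  have bb' : (b * b'^-1 = c^-1 * c')%g.
    by apply: (mulgI c); apply: (mulIg b'); rewrite mulgA mulgVK mulVKg.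
  have hh : (b^-1 * h = b'^-1 * h)%g.
    apply: (over_separated cK iotaM T (over_factor u) ub ub' nb nb').
    apply: testsn; apply/mapP; exists (h, (c, c')).
      by apply/allpairsP; exists (h, (c, c')); split=> //=; apply/allpairsP; exists (c, c').
    by rewrite /= invgM invgK -bb' !mulgA.
  have /invg_inj ebb : (b^-1 = b'^-1)%g by exact: mulIg hh.
  by apply: (mulIg b); rewrite [in RHS]ebb.
have ev : \forall m \near \oo, forall h, h \in s ->
    (count (fun g => `[< B x h g >]) (F m))%:R <= 2 / (size Q)%:R * #|` F m|%:R :> R /\
    (count (fun g => `[< B z h g >]) (F m))%:R <= 2 / (size Q)%:R * #|` F m|%:R :> R.
  apply: near_all_seq => h hs.
  by apply: filterS2 (densB x h hs) (densB z h hs) => m ? ?; split.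
apply: filterS ev => m ev; rewrite lee_fin /mean_distance.
set Phi := F m in ev *.
have Phi0 : 0 < #|` Phi|%:R :> R by rewrite ltr0n cardfs_gt0; case: folF => F0 _; exact: F0.
(* Inside [W n] both values are the common color; outside, both are [None]. *)
have agree g h : ~ B x h g -> ~ B z h g ->
    set_val x (g^-1 * h)%g = set_val z (g^-1 * h)%g.
  move=> nx nz; set l := (g^-1 * h)%g in nx nz *.
  have [WW cc] := color_upto_eq (cxz (iota l)).
  have [Wl|nWl] := pselect (W n ((eta_factor x)^-1 * iota l)%g).
    rewrite (over_value cK iotaM T (over_factor x) Wl).
    by rewrite (over_value cK iotaM T (over_factor z) (WW.1 Wl)) cc.
  have -> : set_val x l = None by apply: contrapT => xl; exact: nx.
  by apply/esym; apply: contrapT => zl; apply: nz; split=> // /WW.2.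
have term g : d (subshift_act eta g x) (subshift_act eta g z) <=
    eps / 4 + C * \sum_(h <- s) ((`[< B x h g >] : nat)%:R + (`[< B z h g >] : nat)%:R).
  have sum0 : 0 <= \sum_(h <- s) ((`[< B x h g >] : nat)%:R + (`[< B z h g >] : nat)%:R) :> R.
    by apply: sumr_ge0 => h _; rewrite addr_ge0.
  have [good|] := pselect (forall h, h \in s -> ~ B x h g /\ ~ B z h g).
    rewrite (@le_trans _ _ (eps / 4))//; last by rewrite lerDl mulr_ge0// ltW.
    by apply/ltW/sP => h /good[nx nz]; rewrite !subshift_actE; exact: agree.
  move=> /existsNP[h /not_implyP[hs nh]].
  rewrite (le_trans (dleC _ _))// -[leLHS]add0r lerD//; first exact: ltW.
  rewrite ler_peMr//; first exact: ltW.
  rewrite (big_rem h)//= -[leLHS]addr0 lerD//; last first.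
    by apply: sumr_ge0 => h' _; rewrite addr_ge0.
  have [Bx|nBx] := pselect (B x h g).
    by rewrite (asboolT Bx) lerDl.
  have [Bz|nBz] := pselect (B z h g); last by case: nh.
  by rewrite (asboolT Bz) lerDr.
rewrite mulrC ler_pdivrMr//.
apply: le_trans (ler_sum _ (fun g _ => term g)) _.
rewrite big_split /= -[X in _ + X]mulr_sumr exchange_big /=.
have -> : \sum_(g <- Phi) eps / 4 = eps / 4 * #|` Phi|%:R.
  by rewrite big_const_seq count_predT iter_addr_0 [RHS]mulr_natr.
have countE (P : set G) :
    \sum_(g <- Phi) (`[< P g >] : nat)%:R = (count (fun g => `[< P g >]) Phi)%:R :> R.
  by rewrite -sum1_count natr_sum [RHS]big_mkcond; apply: eq_bigr => g _; case: asboolP.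
have cnt h : h \in s ->
    \sum_(g <- Phi) ((`[< B x h g >] : nat)%:R + (`[< B z h g >] : nat)%:R) <=
    4 / (size Q)%:R * #|` Phi|%:R :> R.
  move=> hs; have [evx evz] := ev h hs.
  rewrite big_split /= !countE; apply: le_trans (lerD evx evz) _.
  by rewrite -!mulrDl -natrD.
have cntS : \sum_(h <- s) \sum_(g <- Phi)
      ((`[< B x h g >] : nat)%:R + (`[< B z h g >] : nat)%:R) <=
    (size s)%:R * (4 / (size Q)%:R) * #|` Phi|%:R :> R.
  apply: (@le_trans _ _ (\sum_(h <- s) 4 / (size Q)%:R * #|` Phi|%:R)).
    by rewrite !big_seq; exact: ler_sum.
  by rewrite big_const_seq count_predT iter_addr_0 -[leLHS]mulr_natl mulrA.
have : C * (\sum_(h <- s) \sum_(g <- Phi)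
      ((`[< B x h g >] : nat)%:R + (`[< B z h g >] : nat)%:R)) <=
    C * (size s)%:R * (4 / (size Q)%:R) * #|` Phi|%:R.
  by rewrite -2!mulrA ler_pM2l// mulrA.
move=> /le_trans/(_ (ler_wpM2r (ltW Phi0) sQ)) h.
by apply: le_trans (lerD (lexx _) h) _; lra.
Qed.


End FactorMap.

Theorem corollary1p2 (R : realType) (G : groupType)
    (G_countable : countable [set: G]) (G_infinite : infinite_set [set: G])
    (G_residually_finite : residually_finite G) (G_amenable : amenable G R)
    (K : topGroupType) (iota : G -> K)
    (K_compactification : totally_disconnected_metric_compactification R iota)
    (nu : probability (borel_type K) R) (nu_haar : haar_probability nu) :
  exists (S : finType) (eta : config G S),
    [/\ (2 <= #|S|)%N,
        toeplitz eta,
        mean_equicontinuous R (subshift_act eta)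
      & exists2 pi : subshift eta -> K,
          maximal_equicontinuous_factor R
            (subshift_act eta) (translation iota) pi
        & irregular nu pi].
Proof.
case: K_compactification => [[cK mK tdK] [iota_inj iotaM iota_dense]].
have hK : hausdorff_space K by have [d dP] := mK; exact: compatible_metric_hausdorff dP.
have zK := totally_disconnected_zero_dimensional R hK cK tdK.
have /countable_injP[f finj] := G_countable.
(* The enumeration takes the default value [1] at indices outside the range of [f]. *)
pose e n : G := xget 1%g [set g | f g = n].
have e_surj g : exists n, e n = g.
  exists (f g); apply: finj; rewrite ?inE//.
  exact: (@xgetPex _ 1%g [set h | f h = f g] (ex_intro _ g erefl)).
have [p pP] := countable_not_dense G_infinite cK hK zK iota_inj nu_haar (iota \o e).
have p_iota g : iota g <> p by have [n <-] := e_surj g; exact: pP.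
have [Hs [HsP Hs_anti Hs_basis]] := open_normal_basis cK hK zK mK.
have [W [M T]] := tower_ex e G_infinite cK hK zK iota_inj iotaM iota_dense
  nu_haar p_iota HsP.
exists (option bool), (toeplitz_array iota M); split.
- by rewrite card_option card_bool.
- exact: (eta_toeplitz e_surj cK iotaM iota_dense T).
- exact: (factor_mean_equicontinuous G_infinite e_surj cK mK iotaM
    iota_dense HsP Hs_anti Hs_basis T).
- exists (eta_factor cK (M := M) (iota := iota)).
    exact: (factor_maximal G_infinite e_surj cK mK iotaM iota_dense HsP Hs_anti
      Hs_basis T).
  exact: (factor_irregular e_surj cK mK iotaM iota_dense HsP Hs_anti Hs_basis T).
Qed.
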